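(* Let $A:U_\infty\to\mathcal M^{n\times n}_{\rm sym}$ and $b:U_\infty\to\mathbb R^n$ be given functions, and assume there are constants $c_0>0$ and $M_1>0$ such that $\xi^{\rm T}A(x,t)\xi\ge c_0|\xi|^2$ and ${\rm Tr}(A(x,t))\le M_1$ for all $(x,t)\in U_\infty$, $\xi\in\mathbb R^n$. Let $w\in C(\overline{U_\infty})\cap C^{2,1}_{x,t}(U_\infty)$. Assume there is $T^*\ge0$ such that the following hold. (1) There is $F\in C([T^*,\infty),[0,\infty))$ such that $\widetilde Lw(x,t)\le F(t)$ for all $(x,t)\in U\times(T^*,\infty)$. (2) There is a continuous function $z_0(t)>0$ on $[T^*,\infty)$, increasing to infinity as $t\to\infty$, such that $|b(x,t)|\le z_0(t)$ for all $(x,t)\in U\times(T^*,\infty)$. (3) There is a decreasing, continuous function $\Lambda_*(t)\ge0$ on $[T^*,\infty)$ such that $$\max_{(x,\tau)\in\Gamma\times[t,t+1]}w^+(x,\tau)+\int_t^{t+1}F(\tau)\,{\rm d}\tau\le\Lambda_*(t)\quad\text{for all }t\ge T^*.$$ Define $\bar\Lambda(t)=\Lambda_*(t/4)$ for $t\ge4T^*$, and assume further: (4) $\displaystyle\int_{T^*}^\infty e^{-\frac{d}{c_0}z_0(x)}\,{\rm d}x=\infty$. (5) There are numbers $t_*\ge4T^*$ and $\varepsilon_*>0$ such that, for any $\varepsilon\in(0,\varepsilon_* )$, the function $$t\in[t_*,\infty)\mapsto\bar\Lambda(t)\exp\left(e^{-\frac{d^2}{2c_0}-\varepsilon}\int_{t_*}^{t+1}e^{-\frac{d}{c_0}z_0(x)}\,{\rm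 d}x\right)$$ is monotone. If $$\limsup_{t\to\infty}\left(\bar\Lambda(t)e^{\frac{d}{c_0}z_0(t)}\right)=\ell\in[0,\infty),$$ then $w(x,t)$ is bounded from above on $\overline{U_\infty}$ and $$\limsup_{t\to\infty}\left(\max_{x\in\bar U}w^+(x,t)\right)\le e^{\frac{d^2}{2c_0}}\ell.$$
   Context: $n\ge1$ is fixed; $U$ is a non-empty, open, bounded subset of $\mathbb R^n$ with boundary $\Gamma$, closure $\bar U$ and diameter $d=\max\{|x-x'|:x,x'\in\bar U\}$. $U_\infty=U\times(0,\infty)$, $\overline{U_\infty}=\bar U\times[0,\infty)$. $\mathcal M^{n\times n}_{\rm sym}$ is the set of real symmetric $n\times n$ matrices. $C^{2,1}_{x,t}(U\times I)$, for an interval $I$, is the class of continuous functions on $U\times I$ with continuous partial derivatives $\partial u/\partial t$, $\partial u/\partial x_i$, $\partial^2u/\partial x_i\partial x_j$. $\langle A,B\rangle={\rm Tr}(A^{\rm T}B)$; $D^2w$, $\nabla w$ are the Hessian and gradient in $x$. $w^+=\max\{0,w\}$. $\widetilde Lw=w_t-\langle A(x,t),D^2w\rangle+b(x,t)\cdot\nabla w$. ''Increasing'', ''decreasing'' and ''monotone'' are in the non-strict sense. *)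

(* Defs.v *)
From mathcomp Require Import all_boot all_order all_algebra.
From mathcomp Require Import all_classical all_reals all_analysis.

Set Implicit Arguments.
Unset Strict Implicit.
Unset Printing Implicit Defensive.

Import Order.TTheory GRing.Theory Num.Theory.
Import numFieldNormedType.Exports.

Local Open Scope classical_set_scope.
Local Open Scope ring_scope.

(* Points of R^n are row vectors. The library norm `|x| on 'rV[R]_n is the
   sup norm, so the Euclidean norm is defined here; the library topology and
   the predicate bounded_set are the usual ones. *)
Section Definitions.
Context {R : realType} {n : nat}.
Implicit Types (x y : 'rV[R]_n) (t : R) (U : set 'rV[R]_n) (I : set R)
  (u : 'rV[R]_n -> R -> R).

Definition dotv x y : R := \sum_(i < n) x 0 i * y 0 i.

Definition enorm x : R := Num.sqrt (dotv x x).

Definition frobenius (A B : 'M[R]_n) : R := \tr (A^T *m B).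

Definition boundary U : set 'rV[R]_n := closure U `\` U°.

(* For U nonempty and bounded the supremum is a maximum. *)
Definition ediam U : R :=
  sup [set enorm (p.1 - p.2) | p in closure U `*` closure U].

Definition dtime u : 'rV[R]_n -> R -> R := fun x t => derive1 (u x) t.

Definition dspace (i : 'I_n) u : 'rV[R]_n -> R -> R :=
  fun x t => 'D_(delta_mx 0 i) (u^~ t) x.

Definition grad u x t : 'rV[R]_n := \row_i dspace i u x t.

Definition hessian u x t : 'M[R]_n := \matrix_(i, j) dspace i (dspace j u) x t.

Definition continuous_on U I u : Prop :=
  {within U `*` I, continuous (fun p : 'rV[R]_n * R => u p.1 p.2)}.

(* The derivatives are two-sided, so U and I are meant to be open.
   'D and derive1 are total: existence of each derivative is a separate clause. *)
Definition C21 U I u : Prop :=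
  [/\ continuous_on U I u,
      forall x t, U x -> I t ->
        [/\ derivable (u x) t 1,
            forall i, derivable (u^~ t) x (delta_mx 0 i) &
            forall i j, derivable ((dspace j u)^~ t) x (delta_mx 0 i)],
      continuous_on U I (dtime u),
      forall i, continuous_on U I (dspace i u) &
      forall i j, continuous_on U I (dspace i (dspace j u))].

Definition Ltilde (A : 'rV[R]_n -> R -> 'M[R]_n) (b : 'rV[R]_n -> R -> 'rV[R]_n)
    u : 'rV[R]_n -> R -> R := fun x t =>
  dtime u x t - frobenius (A x t) (hessian u x t) + dotv (b x t) (grad u x t).

Definition pospart u : 'rV[R]_n -> R -> R := fun x t => Num.max 0 (u x t).

(* For compact nonempty K `*` J and continuous u this is the maximum. *)
Definition max_on (K : set 'rV[R]_n) (J : set R) u : R :=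
  sup [set u p.1 p.2 | p in K `*` J].

End Definitions.

Section RealFunctions.
Context {R : realType}.
Implicit Types (D : set R) (f : R -> R).

Definition increasing_on D f : Prop :=
  forall s t, D s -> D t -> s <= t -> f s <= f t.

Definition decreasing_on D f : Prop :=
  forall s t, D s -> D t -> s <= t -> f t <= f s.

Definition monotone_on D f : Prop := increasing_on D f \/ decreasing_on D f.

Definition Lambda_bar f : R -> R := fun t => f (t / 4).

Definition limsup_pinfty f : \bar R := limf_esup (fun t => (f t)%:E) +oo.

End RealFunctions.

(* Main.v *)
Require Import Defs.
From mathcomp Require Import all_boot all_order all_algebra.
From mathcomp Require Import all_classical all_reals all_analysis.
From mathcomp Require Import measurable_realfun ring lra.

(** Let m(t) be the maximum of w^+(., t) and r a coordinate, normalised so that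
    0 <= r <= d on the closure of U. On a slab [t, t+1] where |b| <= B, put
    k = (B + 2 d + 1)/c0. The function e^{k (r - d)} is then a strict
    subsolution with gain q = c0 k^2 - B k = k (2 d + 1); multiplied by the
    logistic profile phi(t) = 1 - 1/E(t), where phi' = q phi (1 - phi), it
    remains one, and what is left of the gain feeds a function of time alone.
    By the maximum principle this gives
      m(t+1) <= Lambda(t) + m(t) (1 - eta),  with eta of order B e^{-d B / c0}.
    For large B the factor B absorbs all constants, so
    eta >= h(t) := e^{-d z0(t+1)/c0} for large t. On the other hand
    Lambda(t) = Lambda_bar(4t) <= (l + e) h(t), as 4t >= t + 1. Hence
      m(t+1) - (l + e) <= (1 - h(t)) (m(t) - (l + e)),
    and the divergence of the integral of e^{-d z0 / c0} gives
    limsup m <= l, which is stronger than the claim. *)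

Set Implicit Arguments.
Unset Strict Implicit.
Unset Printing Implicit Defensive.

Import Order.TTheory GRing.Theory Num.Theory.
Import numFieldNormedType.Exports.

Local Open Scope classical_set_scope.
Local Open Scope ring_scope.

(** * Linear algebra *)

Lemma qformE (R : realType) n (M : 'M[R]_n) (x : 'rV[R]_n) :
  (x *m M *m x^T) 0 0 = \sum_i \sum_j x 0 i * x 0 j * M i j.
Proof.
rewrite mxE exchange_big; apply: eq_bigr => j _ /=.
rewrite !mxE mulr_suml; apply: eq_bigr => i _; ring.
Qed.

Lemma frobeniusE (R : realType) n (A H : 'M[R]_n) :
  frobenius A H = \sum_i \sum_j A i j * H i j.
Proof.
rewrite /frobenius /mxtrace exchange_big; apply: eq_bigr => j _ /=.
by rewrite mxE; apply: eq_bigr => i _; rewrite mxE.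
Qed.

Lemma qform_delta2 (R : realType) n (M : 'M[R]_n) (i j : 'I_n) (s t : R) :
  let x : 'rV[R]_n := s *: delta_mx 0 i + t *: delta_mx 0 j in
  (x *m M *m x^T) 0 0 =
  s ^+ 2 * M i i + s * t * (M i j + M j i) + t ^+ 2 * M j j.
Proof.
rewrite /= linearD /= !linearZ /= !trmx_delta !mulmxDl !mulmxDr.
rewrite -?scalemxAl -?scalemxAr -?scalemxAl -!rowE -!colE !mxE; ring.
Qed.

(* Subtracting the rank-one matrix (col i)(row i) / A_ii keeps a positive
   semidefinite matrix positive and kills its i-th diagonal entry, so A is a
   nonnegative combination of rank-one matrices. *)
Lemma frobenius_psd_nsd_le0 (R : realType) n (A H : 'M[R]_n) :
  A^T = A -> (forall x : 'rV_n, 0 <= (x *m A *m x^T) 0 0) ->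
  (forall x : 'rV_n, (x *m H *m x^T) 0 0 <= 0) -> frobenius A H <= 0.
Proof.
move=> + + Hle0.
(* Induction on the number of nonzero diagonal entries, which each rank-one subtraction lowers. *)
have [k] := ubnP #|[set i | A i i != 0]%SET|; elim: k => // k IHk in A *.
move=> Ak Asym Age0.
have symA i j : A i j = A j i by rewrite -{1}Asym mxE.
have diag_ge0 i : 0 <= A i i.
  have := Age0 (1 *: delta_mx 0 i + 0 *: delta_mx 0 i).
  by rewrite qform_delta2; lra.
have zero_row i j : A i i = 0 -> A i j = 0.
  move=> Aii; apply/eqP; apply: contraT => Aij.
  (* With [A i i = 0] the form is affine in the first coefficient; this choice gives it the value
     [- A j j - 2 < 0]. *)
  have := Age0 ((- (A j j + 1) / A i j) *: delta_mx 0 i + 1 *: delta_mx 0 j).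
  rewrite qform_delta2 Aii -(symA i j).
  have -> : (- (A j j + 1) / A i j) ^+ 2 * 0 + - (A j j + 1) / A i j * 1 *
    (A i j + A i j) + 1 ^+ 2 * A j j = - A j j - 2 by field.
  by have := diag_ge0 j; lra.
have [/eqP A0|[i]] := set_0Vmem [set i | A i i != 0]%SET.
  have diag0 i : A i i = 0.
    by apply/eqP; move/eqP/setP/(_ i): A0; rewrite !inE => /negbFE.
  rewrite frobeniusE big1// => i _; rewrite big1// => j _.
  by rewrite zero_row ?mul0r.
rewrite inE => Aii.
have Aii_gt0 : 0 < A i i by rewrite lt0r Aii diag_ge0.
pose A' := \matrix_(a, c) (A a c - A a i * A i c / A i i) : 'M[R]_n.
have FE : frobenius A H =
    frobenius A' H + (row i A *m H *m (row i A)^T) 0 0 / A i i.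
  rewrite qformE !frobeniusE mulr_suml -big_split; apply: eq_bigr => a _ /=.
  rewrite mulr_suml -big_split; apply: eq_bigr => c _ /=.
  by rewrite !mxE (symA a i); field.
rewrite FE; suff : frobenius A' H <= 0.
  by have : (row i A *m H *m (row i A)^T) 0 0 / A i i <= 0
    by [rewrite pmulr_lle0 ?invr_gt0|]; lra.
apply: IHk.
- rewrite ltnS in Ak; apply: leq_trans Ak; apply: proper_card.
  apply/properP; split; last first.
    by exists i; rewrite !inE// !mxE mulfK// subrr eqxx.
  apply/fintype.subsetP => a; rewrite !inE !mxE; apply: contra => /eqP Aaa.
  by rewrite Aaa zero_row// !mul0r subr0.
- by apply/matrixP => a c; rewrite !mxE (symA c a) (symA c i) (symA i a); field.
move=> x.
(* The minimiser of the form of [A] along the line [x + s e_i]: by completing the square, the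
   minimum is the form of [A'] at [x]. *)
pose s := - (x *m A *m (delta_mx 0 i : 'rV_n)^T) 0 0 / A i i.
have := Age0 (x + s *: delta_mx 0 i).
suff -> : ((x + s *: delta_mx 0 i) *m A *m (x + s *: delta_mx 0 i)^T) 0 0 =
  (x *m A' *m x^T) 0 0 by [].
pose L := (x *m A *m (delta_mx 0 i : 'rV_n)^T) 0 0.
have LE : L = \sum_a x 0 a * A a i.
  by rewrite /L trmx_delta -colE !mxE.
have -> : (x *m A' *m x^T) 0 0 = (x *m A *m x^T) 0 0 - L ^+ 2 / A i i.
  rewrite !qformE expr2 {1}LE LE mulr_suml mulr_suml -sumrB.
  apply: eq_bigr => a _ /=.
  rewrite mulr_sumr mulr_suml -sumrB; apply: eq_bigr => c _.
  by rewrite !mxE (symA c i); field.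
have quadE (y : 'rV_n) : ((x + s *: y) *m A *m (x + s *: y)^T) 0 0 =
    (x *m A *m x^T) 0 0 + s * (x *m A *m y^T) 0 0 + s * (y *m A *m x^T) 0 0
    + s ^+ 2 * (y *m A *m y^T) 0 0.
  rewrite linearD /= linearZ /= !mulmxDl !mulmxDr -!scalemxAl -!scalemxAr.
  by rewrite -?scalemxAl !mxE; ring.
have L2 : ((delta_mx 0 i : 'rV_n) *m A *m x^T) 0 0 = L.
  by rewrite LE -rowE mxE; apply: eq_bigr => a _; rewrite !mxE symA mulrC.
have L3 : ((delta_mx 0 i : 'rV_n) *m A *m (delta_mx 0 i : 'rV_n)^T) 0 0 = A i i.
  by rewrite -rowE trmx_delta -colE !mxE.
by rewrite quadE L2 L3 -/L /s -/L; field.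
Qed.

(** * Directional derivatives *)

(** Both derivatives are limits of one and the same difference quotient. *)
Lemma is_derive_line (R : realType) (V : normedModType R) (f : V -> R)
    (x v : V) (s df : R) :
  is_derive (x + s *: v) v f df ->
  is_derive s 1 (fun h => f (x + h *: v)) df.
Proof.
have E : (fun h : R => h^-1 *: (((fun h => f (x + h *: v)) \o shift s) (h *: 1)
      - f (x + s *: v))) =
    (fun h : R => h^-1 *: ((f \o shift (x + s *: v)) (h *: v) - f (x + s *: v))).
  apply/funext => h /=; congr (_ *: (f _ - _)).
  by rewrite [h%:A]mulr1 scalerDl addrCA addrC -addrA addrC -addrA.
by move=> [fd <-]; split; rewrite /derivable /derive E.
Qed.

(** Bounding [|c|] by [|t|] treats both signs of [t] at once, as two-sided limits require. *)
Lemma MVT_line (R : realType) (V : normedModType R) (f : V -> R) (x v : V) (t : R) :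
  (forall s : R, `|s| <= `|t| -> derivable f (x + s *: v) v) ->
  exists2 c : R, `|c| <= `|t| & f (x + t *: v) - f x = t * 'D_v f (x + c *: v).
Proof.
move=> fd.
pose g s := f (x + s *: v); pose dg s := 'D_v f (x + s *: v).
have gd (s : R) : `|s| <= `|t| -> is_derive s 1 g (dg s).
  by move=> st; apply: is_derive_line; apply/derivableP/fd.
have gc (a b : R) : (forall s : R, s \in `[a, b] -> `|s| <= `|t|) ->
    {within `[a, b], continuous g}.
  move=> ab; apply: derivable_within_continuous => s sab.
  by have [] := gd _ (ab _ sab).
have [t0|t0] := leP 0 t.
  have sub (s : R) : s \in `[0, t] -> `|s| <= `|t|.
    by rewrite in_itv /= => /andP[s0 st]; rewrite !ger0_norm.
  have [c c0t E] := MVT_segment t0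
    (fun s st => gd s (sub s (subset_itv_oo_cc st))) (gc _ _ sub).
  exists c; first exact: sub.
  by rewrite -[in f x](addr0 x) -(scale0r v) [LHS]E subr0 mulrC.
have sub (s : R) : s \in `[t, 0] -> `|s| <= `|t|.
  by rewrite in_itv /= => /andP[ts s0]; rewrite !ler0_norm ?(ltW t0)// lerN2.
have [c c0t E] := MVT_segment (ltW t0)
  (fun s st => gd s (sub s (subset_itv_oo_cc st))) (gc _ _ sub).
exists c; first exact: sub.
have -> : f (x + t *: v) - f x = - (g 0 - g t) by rewrite opprB /g scale0r addr0.
by rewrite E sub0r mulrN opprK mulrC.
Qed.

(* The increment along h(u + a v) is split at x + h u; the second leg is
   controlled by the mean value theorem and the continuity of 'D_v f. *)
Lemma is_derive_addZ (R : realType) (V : normedModType R) (f : V -> R)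
    (x u v : V) (a du : R) :
  is_derive x u f du -> (\forall y \near x, derivable f y v) ->
  {for x, continuous ('D_v f)} ->
  is_derive x (u + a *: v) f (du + a * 'D_v f x).
Proof.
move=> [fu fuE] fv fvc.
suff H : h^-1 *: ((f \o shift x) (h *: (u + a *: v)) - f x) @[h --> 0^'] -->
    du + a * 'D_v f x.
  by split; [apply: cvgP H|apply: cvg_lim].
have {}fuE : h^-1 *: ((f \o shift x) (h *: u) - f x) @[h --> 0^'] --> du.
  by rewrite -fuE.
pose k h := h^-1 *: (f (x + h *: u + (h * a) *: v) - f (x + h *: u)).
have -> : (fun h : R => h^-1 *: ((f \o shift x) (h *: (u + a *: v)) - f x)) =
    (fun h => h^-1 *: ((f \o shift x) (h *: u) - f x)) \+ k.
  apply/funext => h /=; rewrite -scalerDr addrC; congr (_ *: _).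
  rewrite scalerDr scalerA (addrC _ x) [h *: u + x]addrC addrA.
  ring.
apply: cvgD => //.
apply/cvgrPdist_lt => e e0.
(* The [+ 1] here, and in [c1] below, keeps the divisor positive when [a], [u] or [v] vanishes. *)
have a1 : 0 < `|a| + 1 by rewrite ltr_wpDl.
have /cvgrPdist_lt/(_ (e / (`|a| + 1))) := fvc.
rewrite divr_gt0// => /(_ isT) near_lt.
have : nbhs x [set y | derivable f y v /\
    `|'D_v f x - 'D_v f y| < e / (`|a| + 1)] by apply: filterI.
move=> /nbhs_ballP[r /= r0 ballr].
have c1 : 0 < `|u| + `|a| * `|v| + 1 by rewrite ltr_wpDl// addr_ge0// mulr_ge0.
near=> h.
have h0 : h != 0 by near: h; exact: nbhs_dnbhs_neq.
have hr : `|h| < r / (`|u| + `|a| * `|v| + 1).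
  by near: h; apply: dnbhs0_lt; rewrite divr_gt0.
have inball (c : R) : `|c| <= `|h * a| -> ball x r (x + h *: u + c *: v).
  move=> ch; rewrite -ball_normE /= opprD addrA opprD addrA subrr sub0r -opprD normrN.
  apply: le_lt_trans (ler_normD _ _) _; rewrite !normrZ.
  apply: (@le_lt_trans _ _ (`|h| * (`|u| + `|a| * `|v| + 1))); last first.
    by rewrite -ltr_pdivlMr.
  rewrite normrM in ch.
  have : `|c| * `|v| <= `|h| * `|a| * `|v| by rewrite ler_wpM2r.
  by have := normr_ge0 h; lra.
have [|c ch E] := @MVT_line R V f (x + h *: u) v (h * a).
  by move=> s /inball/ballr[].
have -> : k h = a * 'D_v f (x + h *: u + c *: v).
  by rewrite /k E [LHS]mulrA mulrA mulVf// mul1r.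
rewrite -mulrBr normrM.
have [_ /= fvlt] := ballr _ (inball _ ch).
apply: le_lt_trans (_ : _ <= `|a| * (e / (`|a| + 1))) _.
  by rewrite ler_wpM2l// ltW.
by rewrite mulrCA gtr_pMr// ltr_pdivrMr// mul1r ltrDl.
Unshelve. all: by end_near. Qed.

(** The direction is built up one coordinate at a time by [is_derive_addZ], each coordinate
    contributing its continuous partial derivative. *)
Lemma is_derive_rV (R : realType) n (f : 'rV[R]_n -> R) (x v : 'rV[R]_n) :
  (forall i, \forall y \near x, derivable f y (delta_mx 0 i)) ->
  (forall i, {for x, continuous ('D_(delta_mx 0 i) f)}) ->
  is_derive x v f (\sum_i v 0 i * 'D_(delta_mx 0 i) f x).
Proof.
move=> fd fc; rewrite {1}(row_sum_delta v).
elim/big_rec2 : _ => [|i du u _ IH]; first exact: is_derive0.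
by rewrite addrC [X in is_derive _ _ _ X]addrC; exact: is_derive_addZ.
Qed.

(** If [d > 0], then [g], which vanishes at 0, is positive just to the right of 0, and the mean
    value theorem makes [f] exceed [f 0] there. *)
Lemma second_derive_at_max (R : realType) (f g : R -> R) (e d : R) :
  0 < e -> (forall s : R, `|s| < e -> is_derive s 1 f (g s)) ->
  is_derive (0 : R) 1 g d -> (forall s : R, `|s| < e -> f s <= f 0) ->
  g 0 = 0 /\ d <= 0.
Proof.
move=> e0 fd [gd gdE] fmax.
have in_e (s : R) : s \in `]- e, e[ -> `|s| < e.
  by rewrite in_itv /= ltr_norml.
have g0 : g 0 = 0.
  have fd0 : is_derive (0 : R) 1 f (g 0) by apply: fd; rewrite normr0.
  have fd0' : is_derive (0 : R) 1 f 0.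
    apply: (@derive1_at_max R f (- e) e 0).
    - by rewrite ge0_cp ?ltW.
    - by move=> s /in_e/fd[].
    - by rewrite in_itv /= oppr_lt0 e0.
    - by move=> s /in_e/fmax.
  by have [_ <-] := fd0; have [_ ->] := fd0'.
split=> //; rewrite leNgt; apply/negP => d0.
have gcvg : h^-1 *: ((g \o shift 0) (h *: 1) - g 0) @[h --> 0^'] --> d.
  by rewrite -gdE.
have /cvgrPdist_lt/(_ _ d0)[r /= r0 gpos] := gcvg.
pose m := Num.min e r / 2.
have m0 : 0 < m by rewrite divr_gt0// lt_min e0.
have [me mr] : m < e /\ m < r.
  have : m < Num.min e r by rewrite /m ltr_pdivrMr// ltr_pMr ?ltr1n// lt_min e0.
  by rewrite lt_min => /andP.
have gp (s : R) : 0 < s -> s <= m -> 0 < g s.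
  move=> s0 sm; have /= := gpos s; rewrite sub0r normrN gtr0_norm// (le_lt_trans sm mr).
  move=> /(_ isT); rewrite gt_eqF// => /(_ isT).
  rewrite g0 subr0 addr0 [s%:A]mulr1 => /ltr_normlP[]; rewrite opprB.
  rewrite ltrBlDr => _; rewrite ltrBlDr ltrDl => gs0.
  by rewrite -(pmulr_rgt0 (g s) (_ : 0 < s^-1)) ?invr_gt0.
have sub (s : R) : s \in `[0, m] -> `|s| < e.
  rewrite in_itv /= => /andP[s0 sm]; rewrite ger0_norm//.
  exact: le_lt_trans me.
have [||c] := @MVT R f g 0 m m0.
- by move=> s /subset_itv_oo_cc/sub/fd.
- by apply: derivable_within_continuous => s /sub/fd[].
rewrite in_itv /= => /andP[c0 cm] E.
have := fmax m; rewrite gtr0_norm// => /(_ me); rewrite -subr_le0 E subr0.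
by rewrite leNgt mulr_gt0// gp// ltW.
Qed.

(** * The comparison principle *)

Lemma open_setX (S T : topologicalType) (U : set S) (V : set T) :
  open U -> open V -> open (U `*` V).
Proof.
move=> Uo Vo; rewrite openE => -[x y] [/= Ux Vy].
by exists (U, V) => //; split; exact: open_nbhs_nbhs.
Qed.

Lemma continuous_on_slice (R : realType) n (U : set 'rV[R]_n) (I : set R)
    (u : 'rV[R]_n -> R -> R) (x : 'rV[R]_n) (t : R) :
  open U -> open I -> U x -> I t -> continuous_on U I u ->
  {for x, continuous (u^~ t)}.
Proof.
move=> Uo Io Ux It; rewrite /continuous_on continuous_open_subspace; last first.
  exact: open_setX.
move=> /(_ (x, t)); rewrite inE => /(_ (conj Ux It)) uc.
apply: (@continuous_comp _ _ _ (fun y => (y, t)) (fun p => u p.1 p.2)) => //.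
move=> P [[A B] /= [xA tB] AB]; apply: filterS xA => y Ay.
by apply: AB; split => //=; exact: nbhs_singleton.
Qed.

(** Only times before [c] are compared, because the maximum over a slab may be attained at its final
    time. The backward difference quotients are nonnegative. *)
Lemma derive_ge0_left_max (R : realType) (g : R -> R) (a c d : R) :
  a < c -> is_derive c 1 g d -> (forall s, a <= s -> s <= c -> g s <= g c) ->
  0 <= d.
Proof.
move=> ac [gd gdE] gmax; rewrite leNgt; apply/negP => d0.
have gcvg : h^-1 *: ((g \o shift c) (h *: 1) - g c) @[h --> 0^'] --> d.
  by rewrite -gdE.
have /cvgrPdist_lt/(_ (- d)) := gcvg; rewrite oppr_gt0 => /(_ d0)[r /= r0 near_d].
pose m := Num.min r (c - a) / 2.
have m0 : 0 < m by rewrite divr_gt0// lt_min r0 subr_gt0.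
have [mr mac] : m < r /\ m < c - a.
  have : m < Num.min r (c - a).
    by rewrite /m ltr_pdivrMr// ltr_pMr ?ltr1n// lt_min r0 subr_gt0.
  by rewrite lt_min => /andP.
have /= := near_d (- m); rewrite sub0r opprK gtr0_norm// => /(_ mr).
rewrite oppr_eq0 gt_eqF// => /(_ isT).
have -> : (- m)%:A + c = c - m by rewrite [_%:A]mulr1 addrC.
have gm : g (c - m) - g c <= 0.
  by rewrite subr_le0 gmax//; lra.
have : 0 <= (- m)^-1 *: (g (c - m) - g c).
  by rewrite mulr_le0// invr_le0 oppr_le0 ltW.
by rewrite ltr_norml; lra.
Qed.

Lemma is_derive_expR_affine (R : realType) (a k s : R) :
  is_derive s 1 (fun h => expR (a + k * h)) (k * expR (a + k * s)).
Proof.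
rewrite mulrC; apply: (@is_derive1_comp R expR (fun h => a + k * h)).
have := is_deriveD (is_derive_cst a s 1) (is_deriveZ k (is_derive_id s 1)).
by rewrite add0r [_ *: _]mulr1.
Qed.

Lemma sum_mul_delta (R : realType) n (f : 'I_n -> 'I_n -> R) (i : 'I_n) :
  \sum_a \sum_b f a b * (delta_mx i i : 'M[R]_n) a b = f i i.
Proof.
rewrite (bigD1 i)//= [X in _ + X]big1 => [|a /negbTE ai]; last first.
  by rewrite big1// => b _; rewrite mxE ai mulr0.
rewrite (bigD1 i)//= [X in _ + X + _]big1 => [|b /negbTE bi]; last first.
  by rewrite mxE bi andbF mulr0.
by rewrite mxE !eqxx mulr1 !addr0.
Qed.

Lemma normr_coord_le_enorm (R : realType) n (x : 'rV[R]_n) i :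
  `|x 0 i| <= enorm x.
Proof.
rewrite /enorm /dotv -sqrtr_sqr ler_sqrt; last first.
  by apply: sumr_ge0 => j _; rewrite -expr2 sqr_ge0.
rewrite (bigD1 i)//= expr2 lerDl.
by apply: sumr_ge0 => j _; rewrite -expr2 sqr_ge0.
Qed.

Lemma enorm_delta (R : realType) n (i : 'I_n) :
  enorm (delta_mx 0 i : 'rV[R]_n) = 1.
Proof.
rewrite /enorm /dotv (bigD1 i)//= big1 => [|j /negbTE ji]; last first.
  by rewrite mxE eqxx ji mul0r.
by rewrite mxE !eqxx mulr1 addr0 sqrtr1.
Qed.

Lemma compact_closure_bounded (R : realType) n (U : set 'rV[R]_n) :
  bounded_set U -> compact (closure U).
Proof.
move=> Ub; apply: bounded_closed_compact; last exact: closed_closure.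
move: Ub; rewrite /bounded_set /bounded_near; apply: filterS => M UM.
have clM : closed [set x : 'rV[R]_n | `|x| <= M].
  by apply: (@closed_comp _ _ _ [set r : R | r <= M]);
    [move=> x _; exact: norm_continuous|exact: closed_le].
by move=> x; rewrite -[X in X x -> _]/(closure U) => /(closureS UM);
  rewrite -(closure_id _).1.
Qed.

Section MaxPrinciple.
Context {R : realType} {n : nat}.
Implicit Types (U : set 'rV[R]_n) (w : 'rV[R]_n -> R -> R) (x xi : 'rV[R]_n).

(** [C21] gives derivatives along the axes only, whereas the maximum principle tests the Hessian
    along every direction [xi]; continuity of the partial derivatives bridges the gap. *)
Lemma C21_line U w x xi (t : R) : open U -> C21 U `]0, +oo[ w -> U x -> 0 < t ->
  is_derive x xi (w^~ t) (\sum_j xi 0 j * dspace j w x t) /\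
  is_derive x xi (fun y => \sum_j xi 0 j * dspace j w y t)
    ((xi *m hessian w x t *m xi^T) 0 0).
Proof.
move=> Uo [_ wd _ wDc wDDc] Ux t0.
have nearU : \forall y \near x, U y by exact: open_nbhs_nbhs.
have It : `]0, +oo[%classic t by rewrite /= in_itv/= t0.
have Io : open (`]0, +oo[%classic : set R) by exact: interval_open.
split.
  apply: is_derive_rV => i.
    by apply: filterS nearU => y Uy; have [_] := wd y t Uy It; exact.
  exact: continuous_on_slice Uo Io Ux It (wDc i).
have H j : is_derive x xi (dspace j w ^~ t)
    (\sum_i xi 0 i * dspace i (dspace j w) x t).
  apply: is_derive_rV => i.
    by apply: filterS nearU => y Uy; have [_ _] := wd y t Uy It; exact.
  exact: continuous_on_slice Uo Io Ux It (wDDc i j).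
rewrite qformE exchange_big /=.
have := is_derive_sum (fun j => is_deriveZ (xi 0 j) (H j)).
set S := \sum_(j < n) _ => HS.
have SE : S = (fun y => \sum_j xi 0 j * dspace j w y t).
  by apply/funext => y; rewrite /S fct_sumE.
rewrite SE in HS; apply: is_derive_eq.
apply: eq_bigr => j _; rewrite scaler_sumr; apply: eq_bigr => i _.
by rewrite !mxE; rewrite [LHS]mulrA (mulrC (xi 0 j)).
Qed.

(* The barrier [p t - c t * expR (k * x 0 i)] varies in one space direction
   only, so that only the entry [A i i >= c0] of the diffusion matters. *)
Lemma parabolic_comparison U w (A : 'rV[R]_n -> R -> 'M[R]_n)
    (b : 'rV[R]_n -> R -> 'rV[R]_n) (i : 'I_n) (c0 B k t1 t2 : R)
    (F p dp c dc : R -> R) :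
  open U -> bounded_set U ->
  (forall x t, U x -> 0 < t -> (A x t)^T = A x t) ->
  0 <= c0 ->
  (forall x t xi, U x -> 0 < t ->
    c0 * enorm xi ^+ 2 <= (xi *m A x t *m xi^T) 0 0) ->
  continuous_on (closure U) `[0, +oo[ w -> C21 U `]0, +oo[ w ->
  0 <= t1 -> 0 <= k ->
  (forall x t, U x -> t1 < t -> t <= t2 -> Ltilde A b w x t <= F t) ->
  (forall x t, U x -> t1 < t -> t <= t2 -> enorm (b x t) <= B) ->
  (forall t, t1 <= t -> t <= t2 -> is_derive t 1 p (dp t)) ->
  (forall t, t1 <= t -> t <= t2 -> is_derive t 1 c (dc t)) ->
  (forall t, t1 <= t -> t <= t2 -> 0 <= c t) ->
  (forall x t, U x -> t1 < t -> t <= t2 ->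
    F t <= dp t - (dc t - (c0 * k ^+ 2 - B * k) * c t) * expR (k * x 0 i)) ->
  (forall x, closure U x -> w x t1 <= p t1 - c t1 * expR (k * x 0 i)) ->
  (forall x t, boundary U x -> t1 <= t -> t <= t2 ->
    w x t <= p t - c t * expR (k * x 0 i)) ->
  forall x t, closure U x -> t1 <= t -> t <= t2 ->
    w x t <= p t - c t * expR (k * x 0 i).
Proof.
move=> Uo Ub Asym c0_ge0 Aell wc wC t1_ge0 k_ge0 LwF bB pd cd c_ge0 barF w_t1 w_bd.
move=> x1 s1 Ux1 t1s1 s1t2; rewrite leNgt; apply/negP => w_gt.
pose W x t := p t - c t * expR (k * x 0 i).
pose K := closure U `*` `[t1, t2]%classic.
have K1 : K (x1, s1) by split => //=; rewrite in_itv /= t1s1.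
have Kcompact : compact K.
  by apply: compact_setX; [exact: compact_closure_bounded|exact: segment_compact].
have t1s1' : t1 < s1.
  rewrite lt_neqAle t1s1 andbT; apply/eqP => t1E.
  by have := w_t1 x1 Ux1; rewrite leNgt t1E w_gt.
(* The penalty [e * (t - t1)] makes the final contradiction strict; this size costs exactly half of
   the excess at [(x1, s1)]. *)
pose e := (w x1 s1 - W x1 s1) / (2 * (s1 - t1)).
have e_gt0 : 0 < e by rewrite divr_gt0 ?subr_gt0// mulr_gt0// subr_gt0.
pose f (q : 'rV[R]_n * R) := w q.1 q.2 - W q.1 q.2 - e * (q.2 - t1).
have fc : {within K, continuous f}.
  apply: within_continuousB.
    apply: within_continuousB.
      apply: continuous_subspaceW wc => -[x t] [/= Ux]; rewrite in_itv /= => /andP[tt _].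
      by split => //=; rewrite in_itv /= (le_trans t1_ge0).
    apply: continuous_in_subspaceT => -[x t]; rewrite inE => -[/= Ux].
    rewrite in_itv /= => /andP[tt1 tt2].
    have sndc (u : R -> R) (du : R) : is_derive t 1 u du ->
        {for (x, t), continuous (fun q : 'rV[R]_n * R => u q.2)}.
      move=> [ud _]; apply: continuous_comp; first exact: cvg_snd.
      by apply: differentiable_continuous; apply/derivable1_diffP.
    apply: cvgB; first exact: sndc (pd t tt1 tt2).
    apply: cvgM; first exact: sndc (cd t tt1 tt2).
    apply: (@continuous_comp _ _ _ (fun q : 'rV[R]_n * R => k * q.1 0 i) expR).
      apply: cvgM; first exact: cvg_cst.
      apply: (@continuous_comp _ _ _ fst (fun y : 'rV[R]_n => y 0 i)).
        exact: cvg_fst.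
      exact: coord_continuous.
    exact: continuous_expR.
  apply: continuous_in_subspaceT => q _.
  apply: cvgM; first exact: cvg_cst.
  by apply: cvgB; [exact: cvg_snd|exact: cvg_cst].
have [[x0 s0]] := compact_EVT_max (ex_intro _ _ K1) Kcompact fc.
rewrite inE => -[/= Ux0]; rewrite in_itv /= => /andP[t1s0 s0t2] fmax.
(* Positivity of the maximum keeps the maximum point off the initial time and off the boundary. *)
have f0_gt0 : 0 < f (x0, s0).
  apply: lt_le_trans (fmax (x1, s1) _); last by rewrite inE.
  have -> : f (x1, s1) = (w x1 s1 - W x1 s1) / 2.
    by rewrite /f /e /=; field; rewrite subr_eq0 gt_eqF.
  by rewrite divr_gt0// subr_gt0.
have t1s0' : t1 < s0.
  rewrite lt_neqAle t1s0 andbT; apply/eqP => t1E.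
  by have := w_t1 x0 Ux0; move: f0_gt0; rewrite /f /= -t1E /W; lra.
have Ux : U x0.
  have [bx|/not_andP[//|/contrapT]] := pselect (boundary U x0); last first.
    exact: interior_subset.
  have es0 : 0 <= e * (s0 - t1) by rewrite mulr_ge0 ?ltW// subr_gt0.
  by have := w_bd x0 s0 bx t1s0 s0t2; move: f0_gt0; rewrite /f /= /W; lra.
have s0_gt0 : 0 < s0 by exact: le_lt_trans t1s0'.
have Is0 : `]0, +oo[%classic s0 by rewrite /= in_itv /= s0_gt0.
set E := expR (k * x0 0 i).
have time_ge0 : 0 <= dtime w x0 s0 - (dp s0 - dc s0 * E) - e.
  apply: (@derive_ge0_left_max R (fun s => f (x0, s)) t1 s0) => //; last first.
    by move=> s t1s ss0; apply: fmax; rewrite inE; split => //=;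
      rewrite in_itv /= t1s (le_trans ss0).
  have [_ wd _ _ _] := wC; have [wtd _ _] := wd x0 s0 Ux Is0.
  have wt : is_derive s0 1 (w x0) (dtime w x0 s0).
    by rewrite /dtime derive1E; exact/derivableP.
  have := is_deriveB (is_deriveB wt (is_deriveB (pd s0 t1s0 s0t2)
     (is_deriveZ E (cd s0 t1s0 s0t2))))
     (is_deriveZ e (is_deriveB (is_derive_id s0 1) (is_derive_cst t1 s0 1))).
  rewrite subr0 [e *: _]mulr1 [E *: _]mulrC; congr is_derive.
  by apply/funext => s; rewrite /f /W /= -/E [c s * _]mulrC.
have [r /= r_gt0 ballU] : exists2 r : R, 0 < r & ball x0 r `<=` U.
  by apply/nbhs_ballP; exact: open_nbhs_nbhs.
(* On lines through [x0] at time [s0] only [w] and the exponential vary, so the one-dimensional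
   criterion is applied to their combination [g0]. *)
have space xi : \sum_j xi 0 j * dspace j w x0 s0 = - (c s0 * k * E) * xi 0 i /\
    (xi *m hessian w x0 s0 *m xi^T) 0 0 <= - (c s0 * k ^+ 2 * E) * xi 0 i ^+ 2.
  pose rho := r / (`|xi| + 1).
  have rho_gt0 : 0 < rho by rewrite divr_gt0// ltr_wpDl.
  have inU (s : R) : `|s| < rho -> U (x0 + s *: xi).
    move=> srho; apply: ballU; rewrite -ball_normE /= opprD addNKr normrN normrZ.
    apply: le_lt_trans (_ : _ <= `|s| * (`|xi| + 1)) _.
      by rewrite ler_wpM2l// lerDl.
    by rewrite -ltr_pdivlMr// ltr_wpDl.
  pose g0 (s : R) := w (x0 + s *: xi) s0 + c s0 * expR (k * x0 0 i + (k * xi 0 i) * s).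
  pose g1 (s : R) := \sum_j xi 0 j * dspace j w (x0 + s *: xi) s0 +
    c s0 * (k * xi 0 i * expR (k * x0 0 i + (k * xi 0 i) * s)).
  have lineE (s : R) : k * (x0 + s *: xi) 0 i = k * x0 0 i + (k * xi 0 i) * s.
    by rewrite !mxE; ring.
  have [||s srho|g10 g2] := @second_derive_at_max R g0 g1 rho
    ((xi *m hessian w x0 s0 *m xi^T) 0 0 +
      c s0 * (k * xi 0 i * (k * xi 0 i * E))) rho_gt0.
  - move=> s /inU Us; have [wx _] := C21_line xi Uo wC Us s0_gt0.
    exact: (is_deriveD (is_derive_line wx)
      (is_deriveZ (c s0) (is_derive_expR_affine _ _ _))).
  - have Us : U (x0 + 0 *: xi) by apply: inU; rewrite normr0.
    have [_ wxx] := C21_line xi Uo wC Us s0_gt0.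
    have := (is_deriveD (is_derive_line wxx)
      (is_deriveZ (c s0) (is_deriveZ (k * xi 0 i) (is_derive_expR_affine (k * x0 0 i) (k * xi 0 i) 0)))).
    by rewrite scale0r addr0 mulr0 addr0.
  - have := fmax (x0 + s *: xi, s0); rewrite inE => /(_ (conj _ _)).
    rewrite /= in_itv /= t1s0 s0t2 => /(_ (subset_closure (inU _ srho)) isT).
    rewrite /f /W /g0 /= lineE scale0r addr0 mulr0 addr0; lra.
  split.
    by move: g10; rewrite /g1 scale0r addr0 mulr0 addr0 -/E; lra.
  by move: g2; rewrite !expr2; lra.
have gradE j : dspace j w x0 s0 = - (c s0 * k * E) * (i == j)%:R.
  have [+ _] := space (delta_mx 0 j); rewrite (bigD1 j)//= big1 ?addr0; last first.
    by move=> l lj; rewrite mxE eqxx /= (negbTE lj) mul0r.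
  by rewrite !mxE !eqxx /= mul1r => ->.
have frobE : frobenius (A x0 s0) (hessian w x0 s0) <=
    - (c s0 * k ^+ 2 * E) * A x0 s0 i i.
  (* By [space], the Hessian minus [D] is negative semidefinite, so its pairing with the positive
     semidefinite [A] is nonpositive; the pairing of [A] with [D] only sees [A i i]. *)
  pose D := - (c s0 * k ^+ 2 * E) *: delta_mx i i : 'M[R]_n.
  have : frobenius (A x0 s0) (hessian w x0 s0 - D) <= 0.
    apply: frobenius_psd_nsd_le0; first exact: Asym.
      by move=> xi; apply: le_trans (Aell _ _ xi Ux s0_gt0); rewrite mulr_ge0// sqr_ge0.
    move=> xi; have [_] := space xi.
    have -> : (xi *m (hessian w x0 s0 - D) *m xi^T) 0 0 =
        (xi *m hessian w x0 s0 *m xi^T) 0 0 + c s0 * k ^+ 2 * E * xi 0 i ^+ 2.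
      rewrite [xi 0 i ^+ 2]expr2 -(sum_mul_delta (fun a b => xi 0 a * xi 0 b)) !qformE.
      rewrite mulr_sumr -big_split; apply: eq_bigr => a _ /=.
      rewrite mulr_sumr -big_split; apply: eq_bigr => b' _ /=.
      by rewrite !mxE; ring.
    by lra.
  suff -> : frobenius (A x0 s0) (hessian w x0 s0 - D) =
      frobenius (A x0 s0) (hessian w x0 s0) + c s0 * k ^+ 2 * E * A x0 s0 i i by lra.
  rewrite -(sum_mul_delta (A x0 s0)) !frobeniusE.
  rewrite mulr_sumr -big_split; apply: eq_bigr => a _ /=.
  rewrite mulr_sumr -big_split; apply: eq_bigr => b' _ /=.
  by rewrite !mxE; ring.
have A_ge : c0 <= A x0 s0 i i.
  have := Aell x0 s0 (delta_mx 0 i) Ux s0_gt0.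
  by rewrite enorm_delta expr1n mulr1 -rowE trmx_delta -colE !mxE.
have dotE : - (B * (c s0 * k * E)) <= dotv (b x0 s0) (grad w x0 s0).
  have -> : dotv (b x0 s0) (grad w x0 s0) = - (b x0 s0 0 i * (c s0 * k * E)).
    rewrite /dotv (bigD1 i)//= big1 ?addr0 => [|j]; rewrite mxE gradE.
      by rewrite eqxx mulr1 mulrN.
    by rewrite eq_sym => /negbTE ->; rewrite !mulr0.
  rewrite lerN2 ler_wpM2r ?mulr_ge0 ?expR_ge0 ?c_ge0//.
  apply: le_trans (ler_norm _) _; apply: le_trans (normr_coord_le_enorm _ _) _.
  exact: bB.
(* The estimates at the maximum point make [Ltilde A b w] at least the right-hand side of [barF]
   plus [e], against [LwF]. *)
have := LwF x0 s0 Ux t1s0' s0t2.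
have := barF x0 s0 Ux t1s0' s0t2.
rewrite /Ltilde -/E.
have : c0 * (c s0 * k ^+ 2 * E) <= A x0 s0 i i * (c s0 * k ^+ 2 * E).
  by rewrite ler_wpM2r// !mulr_ge0 ?expR_ge0 ?sqr_ge0 ?c_ge0.
move: e_gt0 dotE frobE time_ge0; clear; set X := frobenius _ _.
set Y := dotv _ _; set Z := dtime _ _ _; move=> *; lra.
Qed.

End MaxPrinciple.

(** * Decay over a unit time slab *)

Section Front.
Context {R : realType}.

(** [1 - 1 / front] is the logistic profile of rate [q] centred at the midpoint of the slab
    [[t1, t1 + 1]]: for large [q] it is close to 0 at the start and to 1 at the end. *)
Definition front (q t1 t : R) : R := 1 + expR (- (q * (t1 + 2^-1)) + q * t).

Lemma front_gt1 (q t1 t : R) : 1 < front q t1 t.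
Proof. by rewrite ltrDl expR_gt0. Qed.

Lemma front_gt0 (q t1 t : R) : 0 < front q t1 t.
Proof. exact: lt_trans (front_gt1 _ _ _). Qed.

Lemma is_derive_front (q t1 t : R) :
  is_derive t 1 (front q t1) (q * (front q t1 t - 1)).
Proof.
have -> : q * (front q t1 t - 1) = q * expR (- (q * (t1 + 2^-1)) + q * t).
  by rewrite /front addrC addKr.
have := is_deriveD (is_derive_cst (1 : R) t 1)
  (is_derive_expR_affine (- (q * (t1 + 2^-1))) q t).
by rewrite add0r.
Qed.

(** With [phi = 1 - 1 / front], this derivative is [q phi] and that of [1 / front] is
    [- q phi (1 - phi)]. Hence [ln front + 1 / front] is a primitive of [q phi ^ 2], which is how
    both enter [slab_decay]. *)
Lemma is_derive_ln_front (q t1 t : R) : is_derive t 1 (fun s => ln (front q t1 s))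
  (q * (1 - (front q t1 t)^-1)).
Proof.
have := is_derive1_comp (is_derive1_ln (front_gt0 q t1 t)) (is_derive_front q t1 t).
congr is_derive; move: (lt0r_neq0 (front_gt0 q t1 t)).
by set f := front q t1 t => f0; field.
Qed.

Lemma is_derive_inv_front (q t1 t : R) : is_derive t 1 (fun s => (front q t1 s)^-1)
  (- (q * (1 - (front q t1 t)^-1) * (front q t1 t)^-1)).
Proof.
have := is_deriveV (lt0r_neq0 (front_gt0 q t1 t)) (is_derive_front q t1 t).
congr is_derive; rewrite [LHS]mulNr; congr (- _).
move: (lt0r_neq0 (front_gt0 q t1 t)).
by set f := front q t1 t => f0; field.
Qed.

Lemma front_le (q t1 t : R) : 0 <= q -> t1 <= t -> front q t1 t1 <= front q t1 t.
Proof. by move=> q0 tt; rewrite lerD2l ler_expR lerD2l ler_wpM2l. Qed.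

Lemma ln_front_le (q t1 t : R) : 0 <= q -> t <= t1 + 1 ->
  ln (front q t1 t) <= ln (front q t1 t1) + q.
Proof.
move=> q0 tt; rewrite -[X in _ <= _ + X](expRK q) -lnM ?posrE ?expR_gt0 ?front_gt0//.
rewrite ler_ln ?posrE ?mulr_gt0 ?expR_gt0 ?front_gt0// /front mulrDl mul1r -expRD.
rewrite lerD// ?ler_expR; first by rewrite -[1]expR0 ler_expR.
by have : q * t <= q * (t1 + 1) by [rewrite ler_wpM2l|]; lra.
Qed.

(** The centring gives [front] the ratio [(1 + e^(q/2)) / (1 + e^(-q/2)) = e^(q/2)] between end and
    start. *)
Lemma ln_front_end (q t1 : R) : ln (front q t1 (t1 + 1)) = ln (front q t1 t1) + q / 2.
Proof.
rewrite -[X in _ = _ + X](expRK (q / 2)) -lnM ?posrE ?expR_gt0 ?front_gt0//.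
congr ln; rewrite /front mulrDl mul1r -expRD addrC.
rewrite -[X in _ + X](expR0 R); congr (expR _ + expR _); lra.
Qed.

(** With [x = e^(-q/2)] the left side is [x / (1 + x)]. *)
Lemma front_start (q t1 : R) : 1 - (front q t1 t1)^-1 <= expR (- (q / 2)).
Proof.
have E0 : front q t1 t1 = 1 + expR (- (q / 2)).
  by rewrite /front; congr (1 + expR _); lra.
have Egt0 := front_gt0 q t1 t1; rewrite -(ler_pM2r Egt0) mulrBl mulVf ?gt_eqF//.
by rewrite E0; have := sqr_ge0 (expR (- (q / 2))); rewrite expr2; lra.
Qed.

End Front.

Lemma expR_mul_le1 (R : realType) (x : R) : x * expR (- x) <= 1.
Proof.
rewrite expRN ler_pdivrMr ?expR_gt0// mul1r.
by apply: le_trans (expR_ge1Dx x); rewrite lerDr.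
Qed.

(** The barrier is [gam + P t] plus [m] times a factor that is at least 1 at the start, stays
    nonnegative, and is at most [1 - eta] at the end. The choice of [k] gives the gain
    [q = k (2 d + 1)], and [e^(-k d)] bounds the normalised exponential from below. *)
Lemma slab_decay (R : realType) n (U : set 'rV[R]_n) (w : 'rV[R]_n -> R -> R)
    (A : 'rV[R]_n -> R -> 'M[R]_n) (b : 'rV[R]_n -> R -> 'rV[R]_n) (i : 'I_n)
    (c0 B t1 a d gam m : R) (F P : R -> R) :
  open U -> bounded_set U ->
  (forall x t, U x -> 0 < t -> (A x t)^T = A x t) ->
  0 < c0 ->
  (forall x t xi, U x -> 0 < t ->
    c0 * enorm xi ^+ 2 <= (xi *m A x t *m xi^T) 0 0) ->
  continuous_on (closure U) `[0, +oo[ w -> C21 U `]0, +oo[ w ->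
  0 <= t1 -> 0 <= B -> 0 < d -> 0 <= gam -> 0 <= m ->
  (forall x, closure U x -> a <= x 0 i) ->
  (forall x, closure U x -> x 0 i <= a + d) ->
  (forall x t, U x -> t1 < t -> t <= t1 + 1 -> Ltilde A b w x t <= F t) ->
  (forall x t, U x -> t1 < t -> t <= t1 + 1 -> enorm (b x t) <= B) ->
  (forall t, t1 <= t -> t <= t1 + 1 -> is_derive t 1 P (F t)) ->
  P t1 = 0 -> (forall t, t1 <= t -> t <= t1 + 1 -> 0 <= P t) ->
  (forall x, closure U x -> w x t1 <= m) ->
  (forall x t, boundary U x -> t1 <= t -> t <= t1 + 1 -> w x t <= gam) ->
  let k := (B + 2 * d + 1) / c0 in
  let eta := d / (3 * d + 1) * expR (- (k * d)) * (k * (2 * d + 1) / 2 - 1) in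
  forall x, closure U x -> w x (t1 + 1) <= gam + P (t1 + 1) + m * (1 - eta).
Proof.
move=> Uo Ub Asym c0_gt0 Aell wc wC t1_ge0 B_ge0 d_gt0 gam_ge0 m_ge0 a_le le_ad.
move=> LwF bB PF P0 P_ge0 w_m w_gam k eta x Ux.
have k_gt0 : 0 < k by rewrite divr_gt0//; lra.
pose q := k * (2 * d + 1).
have q_gt0 : 0 < q by rewrite mulr_gt0//; lra.
(* [th] solves [th * (1 + (2 d + 1) / d) = 1], where [(2 d + 1) / d] bounds [ek * q] because
   [x e^(-x) <= 1]. *)
pose th := d / (3 * d + 1); pose ek := expR (- (k * d)).
have th_gt0 : 0 < th by rewrite divr_gt0//; lra.
have ek_gt0 : 0 < ek by exact: expR_gt0.
pose E := front q t1; pose E0 := E t1.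
have Egt0 t : 0 < E t by exact: front_gt0.
have iE_le1 t : (E t)^-1 <= 1 by rewrite invf_le1// ltW// front_gt1.
have iE_ge0 t : 0 <= (E t)^-1 by rewrite invr_ge0 ltW.
(* The term [th * (1 - E0^-1)] offsets the exponential at the initial time; the last bracket is the
   integral of [q phi ^ 2] from [t1] to [t], with [phi = 1 - 1 / E]. *)
pose p t := gam + P t + m * (1 + th * (1 - E0^-1) -
  th * ek * (ln (E t) + (E t)^-1 - (ln E0 + E0^-1))).
pose dp t := F t - m * (th * ek * (q * (1 - (E t)^-1) ^+ 2)).
pose c t := m * th * expR (- (k * (a + d))) * (1 - (E t)^-1).
pose dc t := m * th * expR (- (k * (a + d))) * (q * (1 - (E t)^-1) * (E t)^-1).
have cE (y : 'rV[R]_n) t : c t * expR (k * y 0 i) =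
    m * th * (1 - (E t)^-1) * expR (k * (y 0 i - (a + d))).
  by rewrite /c [k * (_ - _)]mulrBr expRD; ring.
have e_le1 y : closure U y -> expR (k * (y 0 i - (a + d))) <= 1.
  move=> /le_ad yad; rewrite -[1]expR0 ler_expR.
  by rewrite pmulr_rle0// subr_le0.
have ek_le y : closure U y -> ek <= expR (k * (y 0 i - (a + d))).
  by move=> /a_le ay; rewrite ler_expR -mulrN ler_wpM2l ?(ltW k_gt0)//; lra.
have Lq : q = c0 * k ^+ 2 - B * k.
  by rewrite /q /k; field; rewrite gt_eqF.
have thq : th * (1 + ek * q) <= 1.
  have : ek * q <= (2 * d + 1) / d.
    rewrite ler_pdivlMr//; have := expR_mul_le1 (k * d); rewrite -/ek => H.
    have : (2 * d + 1) * (k * d * ek) <= (2 * d + 1) * 1 by rewrite ler_wpM2l//; lra.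
    by rewrite /q; lra.
  have th1 : th * (1 + (2 * d + 1) / d) = 1.
    by rewrite /th; field; rewrite !gt_eqF//; lra.
  by move=> H; rewrite -[leRHS]th1 ler_wpM2l ?(ltW th_gt0)// lerD2l.
have main : forall y t, closure U y -> t1 <= t -> t <= t1 + 1 ->
    w y t <= p t - c t * expR (k * y 0 i).
  apply: (@parabolic_comparison R n U w A b i c0 B k t1 (t1 + 1) F p dp c dc
    Uo Ub Asym (ltW c0_gt0) Aell wc wC t1_ge0 (ltW k_gt0) LwF bB).
  - move=> t t1t tt1.
    have := is_deriveD (is_deriveD (is_derive_cst gam t 1) (PF t t1t tt1))
      (is_deriveZ m (is_deriveB (is_derive_cst (1 + th * (1 - E0^-1)) t 1)
        (is_deriveZ (th * ek) (is_deriveB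
          (is_deriveD (is_derive_ln_front q t1 t) (is_derive_inv_front q t1 t))
          (is_derive_cst (ln E0 + E0^-1) t 1))))).
    congr is_derive; rewrite /dp -/E add0r subr0 sub0r /=.
    by rewrite /GRing.scale /=; ring.
  - move=> t t1t tt1.
    have := is_deriveZ (m * th * expR (- (k * (a + d))))
      (is_deriveB (is_derive_cst (1 : R) t 1) (is_derive_inv_front q t1 t)).
    by congr is_derive; rewrite /dc -/E sub0r opprK.
  - move=> t _ _; rewrite /c; apply: mulr_ge0; last by rewrite subr_ge0.
    exact: mulr_ge0 (mulr_ge0 m_ge0 (ltW th_gt0)) (expR_ge0 _).
  (* Of the gain [q phi], the growth of the profile uses [q phi (1 - phi)]; the remaining
     [q phi ^ 2], weighted by an exponential that is at least [ek], pays for the decrease of [p]. *)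
  - move=> y t Uy t1t tt1; rewrite -Lq.
    have -> : (dc t - q * c t) * expR (k * y 0 i) =
      dc t * expR (k * y 0 i) - q * (c t * expR (k * y 0 i)) by ring.
    rewrite cE /dp /dc.
    have := ek_le y (subset_closure Uy).
    have -> : m * th * expR (- (k * (a + d))) * (q * (1 - (E t)^-1) * (E t)^-1) *
      expR (k * y 0 i) = m * th * q * (1 - (E t)^-1) * (E t)^-1 *
         expR (k * (y 0 i - (a + d))).
      by rewrite [k * (_ - _)]mulrBr expRD; ring.
    set e := expR _; set f := (E t)^-1 => eke.
    have : 0 <= m * th * q * (1 - f) ^+ 2 * (e - ek).
      apply: mulr_ge0; last by rewrite subr_ge0.
      exact: mulr_ge0 (mulr_ge0 (mulr_ge0 m_ge0 (ltW th_gt0)) (ltW q_gt0)) (sqr_ge0 _).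
    by rewrite !expr2; lra.
  - move=> y Uy; rewrite cE /p P0 -/E0.
    have := e_le1 y Uy; set e := expR _ => e1.
    have : 0 <= m * th * (1 - E0^-1) * (1 - e).
      apply: mulr_ge0; last by rewrite subr_ge0.
      apply: mulr_ge0; last by rewrite subr_ge0; exact: iE_le1.
      exact: mulr_ge0 m_ge0 (ltW th_gt0).
    by have := w_m y Uy; lra.
  (* The total loss is at most [th * (ek * q + 1) <= 1], so the factor of [m] is nonnegative. *)
  - move=> y t bdy t1t tt1; rewrite cE /p.
    have Uy : closure U y by case: bdy.
    have := e_le1 y Uy; have := expR_ge0 (k * (y 0 i - (a + d))).
    set e := expR _ => e_ge0 e1.
    have lnE : ln (E t) <= ln E0 + q by apply: ln_front_le => //; exact: ltW.
    have iE : (E t)^-1 <= E0^-1.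
      by rewrite lef_pV2 ?posrE// ?Egt0//; apply: front_le => //; exact: ltW.
    have fe : (1 - (E t)^-1) * e <= 1.
      rewrite -[leRHS]mulr1; apply: ler_pM => //; first by rewrite subr_ge0.
      by rewrite gerBl.
    have H1 : th * ek * (ln (E t) + (E t)^-1 - (ln E0 + E0^-1)) <= th * ek * q.
      by rewrite ler_wpM2l ?(mulr_ge0 (ltW th_gt0) (ltW ek_gt0))//; lra.
    have H2 : th * ((1 - (E t)^-1) * e) <= th * 1.
      by rewrite ler_wpM2l// ltW.
    have H3 : 0 <= th * (1 - E0^-1).
      by apply: mulr_ge0 (ltW th_gt0) _; rewrite subr_ge0; exact: iE_le1.
    have : 0 <= m * (1 + th * (1 - E0^-1)
      - th * ek * (ln (E t) + (E t)^-1 - (ln E0 + E0^-1)) - th * ((1 - (E t)^-1) * e)).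
      by apply: mulr_ge0 m_ge0 _; lra.
    have := w_gam y t bdy t1t tt1; have := P_ge0 t t1t tt1; lra.
have t11 : t1 <= t1 + 1 by rewrite lerDl.
apply: le_trans (main x (t1 + 1) Ux t11 (lexx _)) _; rewrite cE /p.
rewrite /E ln_front_end -/E -/E0.
have := ek_le x Ux; set e := expR _ => eke.
(* Here the [2 * d] in [k] is used: it gives [q / 2 >= k * d]. *)
have phi0 : 1 - E0^-1 <= ek.
  apply: le_trans (front_start q t1) _; rewrite ler_expR lerN2 /q.
  by have := mulr_ge0 (ltW k_gt0) (ltW d_gt0); lra.
have : 0 <= m * th * ((1 - (E (t1 + 1))^-1) * (e - ek) + (ek - (1 - E0^-1))
   + ek * (1 - E0^-1)).
  apply: mulr_ge0; first by rewrite mulr_ge0// ltW.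
  apply: addr_ge0; last first.
    by apply: mulr_ge0 (ltW ek_gt0) _; rewrite subr_ge0; exact: iE_le1.
  by rewrite addr_ge0 ?mulr_ge0 ?subr_ge0.
rewrite /eta -/th -/ek -/q; lra.
Qed.

(** [F] is continuous only on [[T, +oo[], but a two-sided derivative is asked at [t1], possibly
    equal to [T]. So [F] is extended by a constant to the left of [T] and integrated from [t1 - 1],
    which makes [t1] an interior point. *)
Lemma primitive_on_unit (R : realType) (F : R -> R) (T t1 : R) :
  {within `[T, +oo[, continuous F} -> (forall t, T <= t -> 0 <= F t) ->
  T <= t1 -> exists P : R -> R,
  [/\ forall t, t1 <= t -> is_derive t 1 P (F t), P t1 = 0,
      forall t, t1 <= t -> 0 <= P t &
      P (t1 + 1) = \int[lebesgue_measure]_(s in `[t1, t1 + 1]) F s].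
Proof.
move=> Fc F_ge0 Tt1.
pose G s := F (Num.max T s).
have GE s : T <= s -> G s = F s by move=> Ts; rewrite /G max_r.
have Gc : continuous G.
  move=> s.
  have mc : {for s, continuous (Num.max T)}.
    have -> : Num.max T = (fun u => (T + u + `|T - u|) / 2).
      by apply/funext => u; rewrite maxr_absE.
    apply: cvgM; last exact: cvg_cst.
    apply: cvgD; first by apply: cvgD; [exact: cvg_cst|exact: cvg_id].
    apply: (@continuous_comp _ _ _ (fun u => T - u) Num.norm); last exact: norm_continuous.
    by apply: cvgB; [exact: cvg_cst|exact: cvg_id].
  have Tmax u : `[T, +oo[%classic (Num.max T u).
    by rewrite /= in_itv /= le_max lexx.
  move/subspace_continuousP : Fc => /(_ _ (Tmax s)) Fc V /Fc /mc H.
  by apply: (filterS _ (H : nbhs s _)) => u Vu; exact: Vu.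
pose I u := \int[lebesgue_measure]_(s in `[t1 - 1, u]) G s.
have Id t : t1 <= t -> is_derive t 1 I (G t).
  move=> t1t; have [||||ID IE] := @continuous_FTC1_closed R G (t1 - 1) t (t + 1).
  - by rewrite ltrDl.
  - apply: continuous_compact_integrable; first exact: segment_compact.
    exact: continuous_subspaceT.
  - by lra.
  - exact: Gc.
  by rewrite -IE derive1E; exact/derivableP.
pose P u := I u - I t1.
have Pd t : t1 <= t -> is_derive t 1 P (F t).
  move=> t1t; rewrite -(GE t) ?(le_trans Tt1)// -[X in is_derive _ _ _ X]subr0.
  exact: (is_deriveB (Id t t1t) (is_derive_cst (I t1) t 1)).
have Pc a b : t1 <= a -> {within `[a, b], continuous P}.
  move=> t1a; apply: derivable_within_continuous => s.
  by rewrite in_itv /= => /andP[as_ _]; have [] := Pd s (le_trans t1a as_).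
have Pcts t : t1 <= t -> {for t, continuous P}.
  move=> t1t; apply: differentiable_continuous; apply/derivable1_diffP.
  by have [] := Pd t t1t.
have P0 : P t1 = 0 by rewrite /P subrr.
exists P; split => //.
  move=> t t1t; have [|c] := @MVT_segment R P F t1 t t1t _ (Pc _ _ (lexx _)).
    by move=> s; rewrite in_itv /= => /andP[t1s _]; apply: Pd; exact: ltW.
  rewrite in_itv /= P0 subr0 => /andP[t1c _] ->.
  by rewrite mulr_ge0 ?subr_ge0// F_ge0// (le_trans Tt1).
rewrite /Rintegral (@continuous_FTC2 R F P t1 (t1 + 1)).
- by rewrite P0 sube0.
- by rewrite ltrDl.
- apply: continuous_subspaceW Fc => s /=; rewrite !in_itv /= andbT => /andP[t1s _].
  exact: le_trans t1s.
- split.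
  + by move=> s; rewrite in_itv /= => /andP[/ltW/Pd[]].
  + by apply: cvg_at_right_filter; apply: Pcts.
  + by apply: cvg_at_left_filter; apply: Pcts; rewrite lerDl.
- move=> s; rewrite in_itv /= => /andP[/ltW/Pd[_ PE] _].
  by rewrite derive1E.
Qed.

(** * Maxima over slabs, and coordinate bounds by the diameter *)

Section MaxOn.
Context {R : realType} {n : nat}.
Implicit Types (K : set 'rV[R]_n) (J : set R) (u : 'rV[R]_n -> R -> R).

Lemma le_max_on K J u (M : R) x t : (forall y s, K y -> J s -> u y s <= M) ->
  K x -> J t -> u x t <= max_on K J u.
Proof.
move=> uM Kx Jt; apply: (@ub_le_sup _ [set u p.1 p.2 | p in K `*` J]); last by exists (x, t).
by exists M => _ [[y s] [/= Ky Js] <-]; exact: uM.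
Qed.

(** The condition [0 <= M] covers the empty index set, whose [sup] is 0 by convention. *)
Lemma max_on_le K J u (M : R) : 0 <= M ->
  (forall y s, K y -> J s -> u y s <= M) -> max_on K J u <= M.
Proof.
move=> M0 uM; rewrite /max_on; set S := [set _ | _ in _].
have [->|/set0P S0] := eqVneq S set0; first by rewrite sup0.
by apply: ge_sup => // _ [[y s] [/= Ky Js] <-]; exact: uM.
Qed.

Lemma max_on_ge0 K J u (M : R) : (forall y s, K y -> J s -> 0 <= u y s <= M) ->
  0 <= max_on K J u.
Proof.
move=> uM; rewrite /max_on; set S := [set _ | _ in _].
have [->|/set0P[_ [[x t] [Kx Jt] _]]] := eqVneq S set0; first by rewrite sup0.
have /andP[u0 _] := uM x t Kx Jt; apply: le_trans u0 _.
by apply: (@le_max_on _ _ _ M) => // y s Ky Js; have /andP[] := uM y s Ky Js.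
Qed.

Lemma bounded_on_slab (U : set 'rV[R]_n) u (T : R) :
  bounded_set U -> continuous_on (closure U) `[0, +oo[ u ->
  exists2 M, 0 <= M & forall x t, closure U x -> 0 <= t -> t <= T -> u x t <= M.
Proof.
move=> Ub uc; pose K := closure U `*` `[0, T]%classic.
have Kc : compact K.
  by apply: compact_setX; [exact: compact_closure_bounded|exact: segment_compact].
have [K0|K0] := pselect (K !=set0); last first.
  exists 0 => // x t Ux t0 tT; exfalso; apply: K0; exists (x, t); split => //=.
  by rewrite in_itv /= t0.
have uK : {within K, continuous (fun q : 'rV[R]_n * R => u q.1 q.2)}.
  apply: continuous_subspaceW uc => -[x t] [/= Ux]; rewrite in_itv /= => /andP[t0 _].
  by split => //=; rewrite in_itv /= t0.
have [c _ cmax] := compact_EVT_max K0 Kc uK.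
exists (Num.max 0 (u c.1 c.2)); first by rewrite le_max lexx.
move=> x t Ux t0 tT; rewrite le_max; apply/orP; right.
by apply: (cmax (x, t)); rewrite inE; split => //=; rewrite in_itv /= t0.
Qed.

(** A coordinate difference is at most a Euclidean distance, and the [sup] in [ediam] dominates the
    distances once they are bounded above, which the sup-norm bound on [closure U] provides. *)
Lemma coord_sub_le_ediam (U : set 'rV[R]_n) x y i :
  bounded_set U -> closure U x -> closure U y -> x 0 i - y 0 i <= ediam U.
Proof.
move=> Ub Ux Uy.
have [M0 [_ M0b]] := compact_bounded (compact_closure_bounded Ub).
have {M0b}Mb z j : closure U z -> `|z 0 j| <= M0 + 1.
  move=> Uz; apply: le_trans (M0b (M0 + 1) _ z Uz); last by rewrite ltrDl.
  by rewrite [`|z|]mx_normrE; exact: (le_bigmax _ _ (0, j)).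
apply: (@le_trans _ _ (enorm (x - y))).
  apply: le_trans (ler_norm _) _; have := normr_coord_le_enorm (x - y) i.
  by rewrite !mxE.
apply: (@ub_le_sup _ [set enorm (p.1 - p.2) | p in closure U `*` closure U]); last by exists (x, y).
exists (Num.sqrt (\sum_(j < n) (2 * (M0 + 1)) ^+ 2)) => _ [[z z'] [/= Uz Uz'] <-].
apply: ler_wsqrtr; apply: ler_sum => j _; rewrite -expr2 -[leLHS](real_normK (num_real _)).
have zz : `|(z - z') 0 j| <= 2 * (M0 + 1).
  rewrite !mxE; apply: le_trans (ler_normB _ _) _.
  by have := Mb z j Uz; have := Mb z' j Uz'; lra.
by apply: lerXn2r => //; rewrite nnegrE // (le_trans _ zz).
Qed.

End MaxOn.

(** * Iteration in time *)

(** On a unit interval a decreasing [g] is at most its value at the left end, so bounded partial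
    sums would bound the integral. *)
Lemma sum_diverges_of_integral (R : realType) (g : R -> R) (T : R) :
  {within `[T, +oo[, continuous g} -> (forall t, T <= t -> 0 <= g t) ->
  decreasing_on `[T, +oo[ g ->
  (\int[lebesgue_measure]_(s in `[T, +oo[) (g s)%:E = +oo)%E ->
  forall K, exists J, K <= \sum_(j < J) g (T + j%:R).
Proof.
move=> gc g_ge0 g_decr g_int K; apply/not_existsP => ltK.
have {}ltK J : \sum_(j < J) g (T + j%:R) <= K.
  by have /negP := ltK J; rewrite -ltNge => /ltW.
(* Half-open intervals tile [[T, +oo[] without overlap, as countable additivity requires. *)
pose D (j : nat) : set R := `[T + j%:R, T + j.+1%:R[%classic.
have Dge j s : D j s -> T + j%:R <= s by rewrite /D /= in_itv /= => /andP[].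
have DT j s : D j s -> T <= s.
  by move=> /Dge; apply: le_trans; rewrite lerDl.
have UD : \bigcup_j D j = `[T, +oo[%classic.
  apply/seteqP; split => s; first by move=> [j _ /DT]; rewrite /= in_itv /= andbT.
  rewrite /= in_itv /= andbT => Ts; exists (Num.truncn (s - T)) => //.
  rewrite /D /= in_itv /=; have := @truncn_itv R (s - T); rewrite subr_ge0 => /(_ Ts).
  by move=> /andP[? ?]; apply/andP; split; lra.
have mD j : measurable (D j) by exact: measurable_itv.
have D1 j : lebesgue_measure (D j) = 1%E.
  rewrite /D lebesgue_measure_itv /= lte_fin ltrD2l ltr_nat ltnSn -EFinD.
  by congr EFin; rewrite -natr1; ring.
have mg : measurable_fun (`[T, +oo[%classic : set R) g.
  by apply: subspace_continuous_measurable_fun.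
suff : (\int[lebesgue_measure]_(s in `[T, +oo[) (g s)%:E <= K%:E)%E.
  by rewrite g_int leye_eq.
rewrite -UD ge0_integral_bigcup //.
- apply: lime_le.
    apply: is_cvg_nneseries => j _ _; apply: integral_ge0 => s Ds.
    by rewrite lee_fin g_ge0// (DT j).
  apply: nearW => J; apply: (@le_trans _ _ (\sum_(0 <= j < J) (g (T + j%:R))%:E)%E).
    apply: lee_sum => j _.
    apply: (@le_trans _ _ (\int[lebesgue_measure]_(s in D j) (cst (g (T + j%:R))%:E s))%E).
      apply: ge0_le_integral => //; first exact: mD.
      + by move=> s Ds; rewrite lee_fin g_ge0// (DT j).
      + apply/measurable_EFinP; apply: measurable_funS mg => //.
        by move=> s /DT; rewrite /= in_itv /= andbT.
      + move=> s Ds; rewrite lee_fin; apply: g_decr.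
        * by rewrite /= in_itv /= andbT lerDl.
        * by rewrite /= in_itv /= andbT (DT j).
        * exact: Dge.
    rewrite integral_cst; last exact: mD.
    by rewrite [X in (_ * X <= _)%E](_ : _ = 1%E) ?mule1//; exact: D1.
  by rewrite sumEFin lee_fin big_mkord.
- by rewrite UD; exact/measurable_EFinP.
- by move=> s [j _ /DT Ts]; rewrite lee_fin g_ge0.
- move=> j k _ _ [s [jS kS]].
  have jk (a c : nat) : D a s -> D c s -> (a <= c)%N.
    rewrite /D /= !in_itv /= => /andP[as_ _] /andP[_ sc].
    by have := le_lt_trans as_ sc; rewrite ltrD2l ltr_nat ltnS.
  by apply/eqP; rewrite eqn_leq !jk.
Qed.

(** The bound asked of the full sum is raised by the first [N] terms, which are then taken away. *)
Lemma tail_sum_diverges (R : realType) (g : nat -> R) (N : nat) :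
  (forall j, 0 <= g j) -> (forall K, exists J, K <= \sum_(j < J) g j) ->
  forall K, exists J, K <= \sum_(j < J) g (N + j)%N.
Proof.
move=> g0 gdiv K; have [J KJ] := gdiv (K + \sum_(j < N) g j); exists J.
rewrite -(lerD2r (\sum_(j < N) g j)); apply: le_trans KJ _.
rewrite -!(big_mkord xpredT g) -(big_mkord xpredT (fun j => g (N + j)%N)).
rewrite addrC; have -> : \sum_(0 <= j < J) g (N + j)%N = \sum_(N <= j < N + J) g j.
  have := @big_addn R 0 +%R 0 (N + J) N xpredT g; rewrite add0n addKn => ->.
  by apply: eq_bigr => j _; rewrite addnC.
rewrite -big_cat_nat//= ?leq_addr//.
rewrite addnC (big_cat_nat (leq0n J) (leq_addr N J)) /=.
by rewrite lerDl sumr_ge0.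
Qed.

(* [1 - x <= expR (- x)] turns the divergence of the sum of the [h j] into the
   convergence to 0 of the product of the contraction factors. *)
Lemma contraction_limit (R : realType) (m h : R -> R) (T L M : R) :
  0 <= M -> (forall t, T <= t -> t <= T + 1 -> m t <= L + M) ->
  decreasing_on `[T, +oo[ h -> (forall t, T <= t -> 0 <= h t <= 1) ->
  (forall t, T <= t -> m (t + 1) - L <= (1 - h t) * (m t - L)) ->
  (forall K, exists J, K <= \sum_(j < J) h (T + j.+1%:R)) ->
  (forall t, T <= t -> m t <= L + M) /\
  forall e, 0 < e -> exists2 T', T <= T' & forall t, T' <= t -> m t <= L + e.
Proof.
move=> M_ge0 m_init h_decr h01 m_step h_div.
(* [C J] bounds [m - L] on [[T + J, T + J + 1]]. The factor for leaving this interval takes [h] at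
   the right end, where the decreasing [h] is smallest; hence the index [j.+1]. *)
pose C J := M * \prod_(j < J) (1 - h (T + j.+1%:R)).
have Tj (j : nat) : T <= T + j%:R by rewrite lerDl.
have f_ge0 (j : nat) : 0 <= 1 - h (T + j%:R).
  by rewrite subr_ge0; have /andP[] := h01 _ (Tj j).
have f_le1 (j : nat) : 1 - h (T + j%:R) <= 1.
  by rewrite gerBl; have /andP[] := h01 _ (Tj j).
have C_ge0 J : 0 <= C J by rewrite mulr_ge0// prodr_ge0.
have CS J : C J.+1 = (1 - h (T + J.+1%:R)) * C J.
  by rewrite /C big_ord_recr /=; ring.
have m_C J t : T + J%:R <= t -> t <= T + J.+1%:R -> m t <= L + C J.
  elim: J t => [|J IHJ] t tJ tJ1.
    by rewrite /C big_ord0 mulr1; apply: m_init; lra.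
  have J1 : (J.+1%:R : R) = J%:R + 1 by rewrite -natr1.
  have J2 : (J.+2%:R : R) = J.+1%:R + 1 by rewrite -natr1.
  have Tt1 : T <= t - 1 by have := Tj J; lra.
  have mt1 : m (t - 1) - L <= C J by rewrite lerBlDl; apply: IHJ; lra.
  have := m_step _ Tt1; rewrite subrK => /le_trans H.
  rewrite -lerBlDl CS; apply: H.
  have /andP[_ ht1] := h01 _ Tt1.
  apply: (@le_trans _ _ ((1 - h (t - 1)) * C J)).
    by rewrite ler_wpM2l// subr_ge0.
  rewrite ler_wpM2r// lerD2l lerN2; apply: h_decr.
  - by rewrite /= in_itv /= andbT.
  - by rewrite /= in_itv /= andbT Tj.
  - lra.
have C_le J J' : (J <= J')%N -> C J' <= C J.
  move=> /subnK <-; elim: (J' - J)%N => [|k IHk]; first by rewrite add0n.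
  by apply: le_trans IHk; rewrite addSn CS ler_piMl.
have m_CJ J t : T + J%:R <= t -> m t <= L + C J.
  move=> Jt; have Tt := le_trans (Tj J) Jt.
  have := @truncn_itv R (t - T); rewrite subr_ge0 => /(_ Tt).
  set k := Num.truncn _ => /andP[kt tk].
  apply: (@le_trans _ _ (L + C k)); first by apply: m_C; lra.
  rewrite lerD2l; apply: C_le.
  have : J%:R < (k.+1)%:R :> R by lra.
  by rewrite ltr_nat ltnS.
split=> [t Tt|e e0].
  by have := @m_CJ 0%N t; rewrite addr0 => /(_ Tt); rewrite /C big_ord0 mulr1.
have C_exp J : C J <= M * expR (- \sum_(j < J) h (T + j.+1%:R)).
  rewrite ler_wpM2l// -sumrN expR_sum; apply: ler_prod => j _.
  by rewrite f_ge0 /=; exact: expR_ge1Dx.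
(* A sum [S >= M / e] suffices, since [S <= expR S] then gives [M * expR (- S) <= e]. *)
have [J] := h_div (M / e).
set S := \sum_(j < J) _ => MS; exists (T + J%:R) => // t Jt.
apply: le_trans (m_CJ J t Jt) _; rewrite lerD2l; apply: le_trans (C_exp J) _.
rewrite -/S expRN ler_pdivrMr ?expR_gt0//.
have : e * (M / e) <= e * expR S.
  rewrite ler_wpM2l ?(ltW e0)//; apply: le_trans MS _.
  by apply: le_trans (expR_ge1Dx S); rewrite lerDr.
by rewrite mulrCA divff ?gt_eqF// mulr1.
Qed.

(** * Limits superior, the decay rate for large drift, and the width of the domain *)

Lemma limsup_pinfty_le (R : realType) (f : R -> R) (l : R) :
  (forall e, 0 < e -> exists T, forall t, T <= t -> f t <= l + e) ->
  (limsup_pinfty f <= l%:E)%E.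
Proof.
move=> fl; apply/lee_addgt0Pr => e e0; have [T fT] := fl e e0.
rewrite /limsup_pinfty /limf_esup.
apply: (@le_trans _ _ (ereal_sup [set (f t)%:E | t in `[T, +oo[%classic])).
  apply: ereal_inf_lbound; exists `[T, +oo[%classic => //.
  by exists T; split; [exact: num_real|move=> t /ltW tT; rewrite /= in_itv /= tT].
apply: ge_ereal_sup => _ [t /= + <-]; rewrite in_itv /= andbT => Tt.
by rewrite -EFinD lee_fin fT.
Qed.

Lemma limsup_pinfty_lt (R : realType) (f : R -> R) (l e : R) :
  limsup_pinfty f = l%:E -> 0 < e -> exists T, forall t, T < t -> f t <= l + e.
Proof.
rewrite /limsup_pinfty /limf_esup => fl e0.
have : (ereal_inf [set ereal_sup [set (f x)%:E | x in V] | V in +oo%R] < (l + e)%:E)%E.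
  by rewrite fl lte_fin ltrDl.
move=> /ereal_inf_lt[_ [V [T [_ VT]] <-]] supV.
exists T => t Tt; rewrite -lee_fin; apply: le_trans (ltW supV).
by apply: ereal_sup_ubound; exists t => //; exact: VT.
Qed.

(** The exponential on the right is [e^(-d B / c0)] times a constant; the constants, collected in
    [C], are absorbed by the last factor, which grows linearly in [B]. *)
Lemma slab_rate_ge (R : realType) (c0 d : R) : 0 < c0 -> 0 < d ->
  exists B0, forall B, B0 <= B -> expR (- (d / c0 * B)) <=
    d / (3 * d + 1) * expR (- ((B + 2 * d + 1) / c0 * d)) *
      ((B + 2 * d + 1) / c0 * (2 * d + 1) / 2 - 1).
Proof.
move=> c0_gt0 d_gt0.
pose C := d / (3 * d + 1) * expR (- ((2 * d + 1) / c0 * d)).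
have C_gt0 : 0 < C by rewrite mulr_gt0 ?expR_gt0// divr_gt0//; lra.
(* Beyond this threshold the last factor is at least [B / (2 c0) - 1 >= 1 / C]. *)
exists (2 * c0 * (1 + C^-1)) => B B_ge.
have -> : (B + 2 * d + 1) / c0 * d = d / c0 * B + (2 * d + 1) / c0 * d.
  by field; rewrite gt_eqF.
rewrite opprD expRD; set e := expR (- (d / c0 * B)).
have e_ge0 : 0 <= e by exact: expR_ge0.
set X := (_ * (2 * d + 1) / 2 - 1).
have -> : d / (3 * d + 1) * (e * expR (- ((2 * d + 1) / c0 * d))) * X = e * (C * X).
  by rewrite /C; ring.
rewrite ler_peMr// -(@mulfV _ C) ?gt_eqF// ler_wpM2l ?(ltW C_gt0)//.
have Bc : 2 * (1 + C^-1) <= B / c0.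
  by rewrite ler_pdivlMr// mulrAC.
have B_ge0 : 0 <= B / c0.
  by apply: le_trans Bc; rewrite mulr_ge0// addr_ge0// invr_ge0 ltW.
have dc : 0 <= (2 * d + 1) / c0 by rewrite divr_ge0 ?(ltW c0_gt0)//; lra.
have XE : X = (B / c0 + (2 * d + 1) / c0) * (2 * d + 1) / 2 - 1.
  by rewrite /X; field; rewrite gt_eqF.
have : 0 <= (B / c0 + (2 * d + 1) / c0) * d by rewrite mulr_ge0 ?(ltW d_gt0)// addr_ge0.
by rewrite XE; lra.
Qed.

(** A short shift of a point of [U] along axis [i] stays in [U], and its length bounds the diameter
    from below. *)
Lemma ediam_gt0 (R : realType) n (U : set 'rV[R]_n) (i : 'I_n) :
  U !=set0 -> open U -> bounded_set U -> 0 < ediam U.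
Proof.
move=> [x Ux] Uo Ub.
have [r /= r_gt0 ballU] : exists2 r : R, 0 < r & ball x r `<=` U.
  by apply/nbhs_ballP; exact: open_nbhs_nbhs.
pose y : 'rV[R]_n := x + (r / (2 * (`|delta_mx 0 i : 'rV[R]_n| + 1))) *: delta_mx 0 i.
set s := r / _ in y.
have s_gt0 : 0 < s by rewrite divr_gt0// mulr_gt0// ltr_wpDl.
have Uy : U y.
  apply: ballU; rewrite -ball_normE /= /y opprD addNKr normrN normrZ gtr0_norm//.
  rewrite /s mulrAC ltr_pdivrMr ?mulr_gt0 ?ltr_wpDl// ltr_pM2l//.
  by have := normr_ge0 (delta_mx 0 i : 'rV[R]_n); lra.
apply: lt_le_trans (coord_sub_le_ediam i Ub (subset_closure Uy) (subset_closure Ux)).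
by rewrite /y !mxE !eqxx mulr1 addrAC subrr add0r.
Qed.

(** [a] is the infimum of the coordinate over the closure; it normalises the coordinate used in the
    barrier. *)
Lemma closure_coord_strip (R : realType) n (U : set 'rV[R]_n) (i : 'I_n) :
  bounded_set U -> exists a, forall x, closure U x -> a <= x 0 i <= a + ediam U.
Proof.
move=> Ub; have [[z Uz]|U0] := pselect (closure U !=set0); last first.
  by exists 0 => x Ux; exfalso; apply: U0; exists x.
pose S := [set x 0 i | x in closure U].
have lbS x : closure U x -> lbound S (x 0 i - ediam U).
  move=> Ux _ [y Uy <-]; have := coord_sub_le_ediam i Ub Ux Uy; lra.
exists (inf S) => x Ux; apply/andP; split.
  by apply: inf_lbound; [exists (z 0 i - ediam U); exact: lbS|exists x].
rewrite -lerBlDr; apply: lb_le_inf; first by exists (z 0 i); exists z.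
exact: lbS.
Qed.

Theorem theorem4p11 (R : realType) (n : nat) (n_ge1 : (1 <= n)%N)
  (U : set 'rV[R]_n) (U_neq0 : U !=set0) (U_open : open U)
  (U_bounded : bounded_set U)
  (A : 'rV[R]_n -> R -> 'M[R]_n) (b : 'rV[R]_n -> R -> 'rV[R]_n)
  (A_sym : forall x t, U x -> 0 < t -> (A x t)^T = A x t)
  (c0 M1 : R) (c0_gt0 : 0 < c0) (M1_gt0 : 0 < M1)
  (A_elliptic : forall x t (xi : 'rV[R]_n), U x -> 0 < t ->
    c0 * enorm xi ^+ 2 <= (xi *m A x t *m xi^T) 0 0)
  (A_trace : forall x t, U x -> 0 < t -> \tr (A x t) <= M1)
  (w : 'rV[R]_n -> R -> R)
  (w_cont : continuous_on (closure U) `[0, +oo[ w)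
  (w_C21 : C21 U `]0, +oo[ w)
  (Tstar : R) (Tstar_ge0 : 0 <= Tstar)
  (F : R -> R) (F_cont : {within `[Tstar, +oo[, continuous F})
  (F_ge0 : forall t, Tstar <= t -> 0 <= F t)
  (Lw_le : forall x t, U x -> Tstar < t -> Ltilde A b w x t <= F t)
  (z0 : R -> R) (z0_cont : {within `[Tstar, +oo[, continuous z0})
  (z0_gt0 : forall t, Tstar <= t -> 0 < z0 t)
  (z0_incr : increasing_on `[Tstar, +oo[ z0)
  (z0_infty : z0 t @[t --> +oo] --> +oo)
  (b_le : forall x t, U x -> Tstar < t -> enorm (b x t) <= z0 t)
  (Lam : R -> R) (Lam_cont : {within `[Tstar, +oo[, continuous Lam})
  (Lam_ge0 : forall t, Tstar <= t -> 0 <= Lam t)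
  (Lam_decr : decreasing_on `[Tstar, +oo[ Lam)
  (Lam_bound : forall t, Tstar <= t ->
    max_on (boundary U) `[t, t + 1] (pospart w)
      + \int[lebesgue_measure]_(tau in `[t, t + 1]) F tau <= Lam t)
  (z0_int : (\int[lebesgue_measure]_(s in `[Tstar, +oo[)
    (expR (- (ediam U / c0 * z0 s)))%:E = +oo)%E)
  (tstar epsstar : R) (tstar_ge : 4 * Tstar <= tstar) (epsstar_gt0 : 0 < epsstar)
  (monotone_eps : forall eps, 0 < eps -> eps < epsstar ->
    monotone_on `[tstar, +oo[ (fun t => Lambda_bar Lam t *
      expR (expR (- (ediam U ^+ 2 / (2 * c0)) - eps) *
        \int[lebesgue_measure]_(s in `[tstar, t + 1])
          expR (- (ediam U / c0 * z0 s)))))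
  (l : R) (l_ge0 : 0 <= l)
  (limsup_l : limsup_pinfty
    (fun t => Lambda_bar Lam t * expR (ediam U / c0 * z0 t)) = l%:E) :
  (exists M : R, forall x t, closure U x -> 0 <= t -> w x t <= M) /\
  (limsup_pinfty (fun t => max_on (closure U) [set t] (pospart w))
    <= (expR (ediam U ^+ 2 / (2 * c0)) * l)%:E)%E.
Proof.
(* The barrier varies along one axis; [n_ge1] provides it. *)
pose i : 'I_n := Ordinal n_ge1.
set d := ediam U in z0_int limsup_l *.
have d_gt0 : 0 < d by exact: ediam_gt0 i _ _ _.
have [a a_le] := closure_coord_strip i U_bounded.
pose m t := max_on (closure U) [set t] (pospart w).
have wM T : exists2 M, 0 <= M & forall x t, closure U x -> 0 <= t -> t <= T ->
    0 <= pospart w x t <= M.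
  have [M M_ge0 wM] := bounded_on_slab T U_bounded w_cont; exists M => // x t Ux t0 tT.
  by rewrite /pospart le_max lexx ge_max M_ge0 /= wM.
have w_m x t : closure U x -> 0 <= t -> w x t <= m t.
  move=> Ux t0; have [M _ {}wM] := wM t.
  apply: (@le_trans _ _ (pospart w x t)); first by rewrite /pospart le_max lexx orbT.
  apply: (@le_max_on _ _ _ _ _ M) => // y s Uy ->.
  by have /andP[] := wM y t Uy t0 (lexx _).
have m_ge0 t : 0 <= t -> 0 <= m t.
  move=> t0; have [M _ {}wM] := wM t.
  by apply: (@max_on_ge0 _ _ _ _ _ M) => y s Uy ->; exact: wM.
have m_le t M : 0 <= M -> (forall x, closure U x -> w x t <= M) -> m t <= M.
  by move=> M0 wtM; apply: max_on_le => // y s Uy ->; rewrite /pospart ge_max M0 wtM.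
pose g t := expR (- (d / c0 * z0 t)).
have dc_ge0 : 0 <= d / c0 by rewrite divr_ge0 ?ltW.
have itvT t : Tstar <= t -> `[Tstar, +oo[%classic t.
  by move=> Tt; rewrite /= in_itv /= Tt.
have g_decr s t : Tstar <= s -> s <= t -> g t <= g s.
  move=> Ts st; rewrite ler_expR lerN2 ler_wpM2l//; apply: z0_incr => //.
    exact: itvT.
  by apply: itvT; exact: le_trans st.
have g01 t : Tstar <= t -> 0 <= g t <= 1.
  move=> Tt; rewrite expR_ge0 -[leRHS]expR0 ler_expR oppr_le0 mulr_ge0//.
  exact/ltW/z0_gt0.
have [B0 rate] := slab_rate_ge c0_gt0 d_gt0.
have [T1 z0_big] : exists T1, forall t, T1 < t -> B0 <= z0 t.
  move/cvgryPge : z0_infty => /(_ B0)[T1 [_ HT]]; exists T1 => t; exact: HT.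
(* On the slab [[t, t + 1]] the drift is bounded by [z0 (t + 1)], as [z0] increases; beyond [T1]
   this bound is large enough for [rate] to replace [eta] by [g (t + 1)]. *)
have m_step t : Tstar <= t -> T1 <= t -> m (t + 1) <= Lam t + m t * (1 - g (t + 1)).
  move=> Tt T1t; have t0 := le_trans Tstar_ge0 Tt.
  have Tt1 : Tstar <= t + 1 by lra.
  have [P [PF P0 P_ge0 PE]] := primitive_on_unit F_cont F_ge0 Tt.
  have [M M0 {}wM] := wM (t + 1).
  set gam := max_on (boundary U) `[t, t + 1] (pospart w).
  have bdM y s : boundary U y -> `[t, t + 1]%classic s -> 0 <= pospart w y s <= M.
    move=> [Uy _]; rewrite /= in_itv /= => /andP[ts st].
    by apply: wM => //; exact: le_trans ts.
  have gam_ge0 : 0 <= gam by exact: max_on_ge0 bdM.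
  have LamP : gam + P (t + 1) <= Lam t by rewrite PE; exact: Lam_bound.
  have z0t1 : 0 <= z0 (t + 1) by exact/ltW/z0_gt0.
  have /rate gP : B0 <= z0 (t + 1) by apply: z0_big; lra.
  have LamP_ge0 : 0 <= Lam t by exact: Lam_ge0.
  have g1 : 0 <= m t * (1 - g (t + 1)).
    by rewrite mulr_ge0 ?m_ge0// subr_ge0; have /andP[] := g01 _ Tt1.
  apply: m_le => [|x Ux]; first exact: addr_ge0.
  have slab := @slab_decay R n U w A b i c0 (z0 (t + 1)) t a d gam (m t) F P
    U_open U_bounded A_sym c0_gt0 A_elliptic w_cont w_C21 t0 z0t1 d_gt0 gam_ge0
    (m_ge0 t t0).
  apply: le_trans (slab _ _ _ _ _ P0 _ _ _ x Ux) _.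
  - by move=> y /a_le/andP[].
  - by move=> y /a_le/andP[].
  - by move=> y s Uy ts _; apply: Lw_le => //; exact: le_lt_trans ts.
  - move=> y s Uy ts st; apply: le_trans (b_le y s Uy (le_lt_trans Tt ts)) _.
    apply: z0_incr => //; apply: itvT => //; exact: le_trans Tt (ltW ts).
  - by move=> s ts _; exact: PF.
  - by move=> s ts _; exact: P_ge0.
  - by move=> y Uy; exact: w_m.
  - move=> y s bdy ts st; apply: (@le_trans _ _ (pospart w y s)).
      by rewrite /pospart le_max lexx orbT.
    apply: (@le_max_on _ _ _ _ _ M) => //; last by rewrite /= in_itv /= ts.
    by move=> y' s' /bdM H /H/andP[].
  by apply: lerD => //; rewrite ler_wpM2l ?m_ge0// lerD2l lerN2.
have g_div K : exists J, K <= \sum_(j < J) g (Tstar + j%:R).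
  apply: sum_diverges_of_integral => //.
  - have gE : g = (fun y => expR (0 + - (d / c0) * y)) \o z0.
      by apply/funext => t; rewrite /= add0r mulNr.
    rewrite gE; apply: within_continuous_comp => // y _.
    apply: differentiable_continuous; apply/derivable1_diffP.
    by have [] := is_derive_expR_affine 0 (- (d / c0)) y.
  - by move=> t /g01/andP[].
  - by move=> s t; rewrite /= !in_itv /= !andbT => Ts _; exact: g_decr.
have Lam_le e : 0 < e -> exists T2, forall t, T2 < t -> Tstar <= t -> 1 <= t ->
    Lam t <= (l + e) * g (t + 1).
  move=> e0; have [T2 HT2] := limsup_pinfty_lt limsup_l e0.
  exists (T2 / 4) => t Tt Tst t1.
  (* At [4 * t], [Lambda_bar] takes the value [Lam t]; then [g (4 * t) <= g (t + 1)] because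
     [t + 1 <= 4 * t]. *)
  have := HT2 (4 * t); rewrite /Lambda_bar mulrAC divff ?pnatr_eq0// mul1r => H.
  have {}H : Lam t * expR (d / c0 * z0 (4 * t)) <= l + e by apply: H; lra.
  apply: (@le_trans _ _ ((l + e) * g (4 * t))).
    by rewrite /g expRN ler_pdivlMr ?expR_gt0.
  by rewrite ler_wpM2l ?addr_ge0 ?(ltW e0)//; apply: g_decr; lra.
have key e : 0 < e -> exists T M, [/\ 0 <= M, 0 <= T,
    forall x t, closure U x -> 0 <= t -> t <= T -> w x t <= M,
    forall t, T <= t -> m t <= l + e + M &
    forall e', 0 < e' -> exists2 T', T <= T' & forall t, T' <= t -> m t <= l + e + e'].
  move=> e0; have [T2 LamT2] := Lam_le e e0.
  (* [T] lies an integer beyond [Tstar], so that the times sampled by the iteration are among those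
     of the divergent sum in [g_div]; [N] is large enough to pass 1, [T1] and [T2]. *)
  pose N := (Num.truncn (`|T1| + `|T2| + 1)).+1; pose T := Tstar + N%:R.
  have NT : `|T1| + `|T2| + 1 < N%:R by exact: truncnS_gt.
  have TT : [/\ Tstar <= T, 1 <= T, T1 <= T & T2 < T].
    have := ler_norm T1; have := ler_norm T2; have := normr_ge0 T1.
    by have := normr_ge0 T2; split; rewrite /T; lra.
  case: TT => TsT T_ge1 T1T T2T.
  have T_ge0 : 0 <= T by lra.
  (* The bound up to [T + 1] covers the first unit interval of the iteration. *)
  have [M M_ge0 {}wM] := wM (T + 1); exists T, M.
  have w_le x t : closure U x -> 0 <= t -> t <= T + 1 -> w x t <= M.
    move=> Ux t0 tT; have /andP[_] := wM x t Ux t0 tT.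
    by rewrite /pospart ge_max => /andP[].
  have [|||||m1 m2] := @contraction_limit R m (fun t => g (t + 1)) T (l + e) M M_ge0.
  - move=> t Tt tT; apply: (@le_trans _ _ M); last by rewrite lerDr addr_ge0// ltW.
    by apply: m_le => // x Ux; apply: w_le => //; lra.
  - by move=> s t; rewrite /= !in_itv /= !andbT => Ts _ st; apply: g_decr; lra.
  - by move=> t Tt; apply: g01; lra.
  (* Inserting [Lam t <= (l + e) * g (t + 1)] into [m_step] makes [l + e] the fixed point of the
     recursion. *)
  - move=> t Tt; have T1t := le_trans T1T Tt; have Tst := le_trans TsT Tt.
    have := m_step t Tst T1t.
    have := LamT2 t (lt_le_trans T2T Tt) Tst (le_trans T_ge1 Tt); lra.
  (* The shift [N.+2] counts [N] from [T], one from the index [j.+1], and one from evaluating [g] at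
     [t + 1]. *)
  - move=> K; have [||J] := @tail_sum_diverges R (fun j => g (Tstar + j%:R)) N.+2 _ _ K.
    + by move=> j; have /andP[] : 0 <= g (Tstar + j%:R) <= 1 by apply: g01; rewrite lerDl.
    + exact: g_div.
    move=> KJ; exists J; apply: le_trans KJ _; apply: ler_sum => j _.
    rewrite le_eqVlt; apply/orP; left; apply/eqP; congr g.
    by rewrite /T natrD -!natr1; ring.
  split=> //; first by move=> x t Ux t0 tT; apply: w_le => //; lra.
split.
  have [T [M [M_ge0 T_ge0 w_le m_le' _]]] := key 1 ltr01.
  exists (l + 1 + M) => x t Ux t0; have [tT|Tt] := leP t T.
    by apply: le_trans (w_le x t Ux t0 tT) _; rewrite lerDr addr_ge0.
  by apply: le_trans (w_m x t Ux t0) (m_le' _ (ltW Tt)).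
(* The limit superior is at most [l], and the exponential factor is at least 1. *)
apply: (@le_trans _ _ l%:E); last first.
  rewrite lee_fin ler_peMl// -expR0 ler_expR divr_ge0 ?sqr_ge0//.
  by rewrite mulr_ge0// ltW.
apply: limsup_pinfty_le => e e0.
(* Half of [e] enlarges the limit [l]; the other half is the error left by the iteration. *)
have e2 : 0 < e / 2 by rewrite divr_gt0.
have [T [M [_ _ _ _ /(_ _ e2)[T' _ HT']]]] := key _ e2.
by exists T' => t /HT'; rewrite -addrA -splitr.
Qed.
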